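(* There exist absolute constants $u>0$ and $C>0$ such that the following holds. For every $0<\rho<1$ and $0\le\mu<1$ there exists $\epsilon(\rho,\mu)>0$ such that, whenever $f:\Omega_1\times\cdots\times\Omega_n\to[0,1]$ is a function on a finite product probability space with $\mathbf{E}[f]=\mu$ for which the minimum probability of any atom in each $\Omega_i$ is at least $\alpha$ ($0<\alpha\le1/2$), and whenever $0<\tau<1/2$ is such that $\mathrm{Inf}_i^{\le\log(1/\tau)/K'}(f)\le\tau$ for all $i$, where $K'=\log(1/(\alpha\rho(1-\rho)))$, then for all $0<\epsilon\le\epsilon(\rho,\mu)$, $$\mathbf{P}[V_\rho f>1-\delta]\le\epsilon$$ provided $$\delta<\epsilon^{\rho/(1-\rho)+C\kappa},\qquad \tau\le\epsilon^{\frac{100K'}{u(1-\rho)}\left(\frac{1}{(1-\rho)^3}+C\kappa\right)},$$ where $$\kappa=\frac{\sqrt{c(\mu)}}{1-\rho}\cdot\frac{1}{\sqrt{\log(1/\epsilon)}},\qquad c(\mu)=\mu\log\bigl(e/(1-\mu)\bigr)+\epsilon.$$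
   Context: $\log$ is the natural logarithm. Each $(\Omega_i,\mu_i)$ is a finite probability space and $\Omega_1\times\cdots\times\Omega_n$ has the product measure. The operator $V_\rho$ takes $f:\Omega_1\times\cdots\times\Omega_n\to\mathbb{R}$ to a function $V_\rho f$ on $\Omega_1\times\cdots\times\Omega_n\times\{0,1\}^n$, where $\{0,1\}^n$ has the product measure under which each coordinate is $1$ with probability $\rho$ and $0$ with probability $1-\rho$: $(V_\rho f)(\omega,x)=\mathbf{E}_{\omega'}[f(z_1,\dots,z_n)]$, where $\omega'$ is drawn from the product measure, $z_i=\omega_i$ if $x_i=1$ and $z_i=\omega_i'$ if $x_i=0$. The probability $\mathbf{P}[V_\rho f>1-\delta]$ is over $(\omega,x)$. Low-degree influences: for each $i$ choose an orthonormal basis $X_{i,0}=1,X_{i,1},X_{i,2},\dots$ of the real functions on $\Omega_i$, and expand $f=\sum_\sigma c_\sigma\prod_{i=1}^nX_{i,\sigma_i}$ over multi-indices $\sigma\in\mathbb{N}^n$ ($0\in\mathbb{N}$). With $|\sigma|=\#\{i:\sigma_i>0\}$, $\mathrm{Inf}_i^{\le d}(f)=\sum_{|\sigma|\le d,\ \sigma_i>0}c_\sigma^2$ for real $d\ge0$ (independent of the choice of bases). *)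

(* Defs.v *)
From mathcomp Require Import all_boot all_order all_algebra.
From mathcomp Require Import all_classical all_reals all_analysis.

Set Implicit Arguments.
Unset Strict Implicit.
Unset Printing Implicit Defensive.

Import Order.TTheory GRing.Theory Num.Theory.
Local Open Scope ring_scope.

(* A probability measure on a finite type is given by its point masses w. *)

Definition is_prob (R : realType) (T : finType) (w : T -> R) : Prop :=
  (forall t, 0 <= w t) /\ \sum_t w t = 1.

Definition expect (R : realType) (T : finType) (w f : T -> R) : R :=
  \sum_t w t * f t.

Definition prob (R : realType) (T : finType) (w : T -> R) (A : pred T) : R :=
  \sum_(t | A t) w t.

Definition prod_mass (R : realType) (n : nat) (Omega : 'I_n -> finType)
    (w : forall i, Omega i -> R) (t : {dffun forall i, Omega i}) : R :=
  \prod_i w i (t i).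

(* true encodes 1, false encodes 0. *)
Definition bernoulli_mass (R : realType) (rho : R) (b : bool) : R :=
  if b then rho else 1 - rho.

Definition cube (n : nat) : finType := {dffun forall _ : 'I_n, bool}.

Definition cube_mass (R : realType) (n : nat) (rho : R) (x : cube n) : R :=
  prod_mass (fun _ => bernoulli_mass rho) x.

Definition mix (n : nat) (Omega : 'I_n -> finType) (x : cube n)
    (t t' : {dffun forall i, Omega i}) : {dffun forall i, Omega i} :=
  [ffun i => if x i then t i else t' i].

(* As a function on the product of the Omega i and the cube, V_rho f does not
   involve rho: rho only enters the measure put on the cube. *)
Definition Vop (R : realType) (n : nat) (Omega : 'I_n -> finType)
    (w : forall i, Omega i -> R) (f : {dffun forall i, Omega i} -> R)
    (p : {dffun forall i, Omega i} * cube n) : R :=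
  expect (prod_mass w) (fun t' => f (mix p.2 p.1 t')).

Definition joint_mass (R : realType) (n : nat) (Omega : 'I_n -> finType)
    (w : forall i, Omega i -> R) (rho : R)
    (p : {dffun forall i, Omega i} * cube n) : R :=
  prod_mass w p.1 * cube_mass rho p.2.

Definition orthonormal_basis1 (R : realType) (T : finType) (w : T -> R)
    (m : nat) (X : 'I_m.+1 -> T -> R) : Prop :=
  [/\ forall t, X ord0 t = 1,
      forall j k, expect w (fun t => X j t * X k t) = (j == k)%:R
    & forall g : T -> R, exists c : 'I_m.+1 -> R,
        forall t, g t = \sum_j c j * X j t].

(* The multi-indices for which prod_i X_(i, sigma_i) is defined, when the
   basis of functions on the i-th factor is X_(i, 0), ..., X_(i, m i). *)
Definition mindex (n : nat) (m : 'I_n -> nat) : finType :=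
  {dffun forall i : 'I_n, 'I_(m i).+1}.

Definition mdegree (n : nat) (m : 'I_n -> nat) (s : mindex m) : nat :=
  #|[pred i | (0 < s i)%N]|.

Definition is_expansion (R : realType) (n : nat) (Omega : 'I_n -> finType)
    (m : 'I_n -> nat) (X : forall i, 'I_(m i).+1 -> Omega i -> R)
    (f : {dffun forall i, Omega i} -> R) (c : mindex m -> R) : Prop :=
  forall t, f t = \sum_(s : mindex m) c s * \prod_i X i (s i) (t i).

(* Inf_i^(<= d) of the function with coefficients c. *)
Definition low_inf (R : realType) (n : nat) (m : 'I_n -> nat)
    (c : mindex m -> R) (d : R) (i : 'I_n) : R :=
  \sum_(s : mindex m | ((mdegree s)%:R <= d) && (0 < s i)%N) c s ^+ 2.

Definition Kprime (R : realType) (alpha rho : R) : R :=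
  ln (1 / (alpha * rho * (1 - rho))).

Definition c_mu (R : realType) (mu eps : R) : R :=
  mu * ln (expR 1 / (1 - mu)) + eps.

Definition kappa (R : realType) (rho mu eps : R) : R :=
  Num.sqrt (c_mu mu eps) / (1 - rho) * (1 / Num.sqrt (ln (1 / eps))).

(* Main.v *)
Require Import Defs.
From mathcomp Require Import all_boot all_order all_algebra.
From mathcomp Require Import all_classical all_reals all_analysis.
From mathcomp Require Import ring lra.

Set Implicit Arguments.
Unset Strict Implicit.
Unset Printing Implicit Defensive.

Import Order.TTheory GRing.Theory Num.Theory.
Local Open Scope ring_scope.

(* Put h = 1 - (1 - eta) f, with values in [eta, 1], and reveal the coordinates
   of omega at random, the set revealed at time s having density s.  The
   conditional mean v of h runs from E h at time 0 to V_rho h at time rho.  If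
   its jumps are small, a level-1 inequality bounds its quadratic variation by
   2 v^2 ln(1/v) ds / (1 - s), exactly as for a Gaussian martingale, and then
   v^(-a(s)) with a' = - a (a + 1) / (1 - s) is a supermartingale up to an
   error.  The solution with a / (a + 1) = (1 - theta)(1 - s) stays finite down
   to s = 0 and has a(rho) close to (1 - rho) / rho, so Markov's inequality at
   time rho gives P[V_rho h <= 2 eta] <= eta^((1 - rho) / rho) up to lower-order
   factors, which are optimized by theta = sqrt(c(mu) / ln(1/eps)).

   The jumps are small in L^4: revealing coordinate i at a time s <= rho changes
   v by a polynomial whose low-degree part is controlled by Bonami's inequality
   and Inf_i, and whose part of degree k has weight at most k rho^(k - 1). *)

(** * Expectations and product spaces *)

(** The equation for [a] is forced. With y = v^(-a), the reveals contribute a (a + 1) / 2 * y / v^2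
    times the quadratic variation, hence at most a (a + 1) y ln(1/v) ds / (1 - s), while moving the
    exponent contributes a' y ln(1/v) ds; the two cancel.

    The solution with a(rho) = (1 - rho) / rho is infinite at s = 0, where the potential starts near
    (1 - mu)^(-a(0)). Lowering the constant 1 to 1 - theta gives a(0) = 1/theta - 1. This costs a
    factor e^(M / theta) at the start, with M = ln(1 / (1 - mu)), and a loss of order theta *
    ln(1/eps) in the exponent at time rho. Balancing suggests theta^2 of order M / ln(1/eps); c(mu)
    is at least M / 2 and also at least mu, which keeps theta * ln(1/eps) large.

    The two regularizations make the errors tractable. The shift by eta keeps v >= eta, so relative
    jumps are at most |jump| / eta, and capping the power at 1 / lam bounds the potential and its
    slope. All errors are then polynomial in 1/eta, 1/lam and 1/theta, that is, at most a fixed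
    power of e^(ln(1/eps) / (1 - rho)), which sufficiently small fourth moments of the jumps
    beat. *)

Lemma eq_ler (R : realType) (x y : R) : x = y -> x <= y.
Proof. by move=> ->. Qed.

Section Expectation.
Context (R : realType) (T : finType) (w : T -> R).

Lemma eq_expect f g : f =1 g -> expect w f = expect w g.
Proof. by move=> fg; apply: eq_bigr => t _; rewrite fg. Qed.

Lemma expectD f g : expect w (fun t => f t + g t) = expect w f + expect w g.
Proof. by rewrite -big_split; apply: eq_bigr => t _; rewrite mulrDr. Qed.

Lemma expectZ k f : expect w (fun t => k * f t) = k * expect w f.
Proof. by rewrite /expect big_distrr; apply: eq_bigr => t _; rewrite mulrCA. Qed.

Lemma expectZr k f : expect w (fun t => f t * k) = expect w f * k.
Proof. by rewrite mulrC -expectZ; apply: eq_expect => t; rewrite mulrC. Qed.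

Lemma expectN f : expect w (fun t => - f t) = - expect w f.
Proof. by rewrite -mulN1r -expectZ; apply: eq_expect => t; rewrite mulN1r. Qed.

Lemma expectB f g : expect w (fun t => f t - g t) = expect w f - expect w g.
Proof. by rewrite expectD expectN. Qed.

Lemma expect_sum (I : Type) (r : seq I) (P : pred I) (F : I -> T -> R) :
  expect w (fun t => \sum_(i <- r | P i) F i t)
  = \sum_(i <- r | P i) expect w (F i).
Proof.
by rewrite exchange_big; apply: eq_bigr => t _; rewrite big_distrr.
Qed.

Hypothesis Pw : is_prob w.

Lemma expect_cst k : expect w (fun _ => k) = k.
Proof. by rewrite /expect -big_distrl /= Pw.2 mul1r. Qed.

Lemma le_expect f g : (forall t, f t <= g t) -> expect w f <= expect w g.
Proof. by move=> fg; apply: ler_sum => t _; rewrite ler_wpM2l// Pw.1. Qed.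

Lemma expect_ge0 f : (forall t, 0 <= f t) -> 0 <= expect w f.
Proof. by move=> f0; apply: sumr_ge0 => t _; rewrite mulr_ge0// Pw.1. Qed.

(** Lagrange's identity: the double average of [(f s * g t - f t * g s) ^+ 2] is twice the
    difference of the two sides, so a vanishing norm needs no separate case. *)
Lemma expect_cauchy f g :
  expect w (fun t => f t * g t) ^+ 2
  <= expect w (fun t => f t ^+ 2) * expect w (fun t => g t ^+ 2).
Proof.
have : 0 <= expect w (fun s => expect w (fun t => (f s * g t - f t * g s) ^+ 2)).
  by apply: expect_ge0 => s; apply: expect_ge0 => t; rewrite sqr_ge0.
have -> : expect w (fun s => expect w (fun t => (f s * g t - f t * g s) ^+ 2))
   = expect w (fun s => f s ^+ 2 * expect w (fun t => g t ^+ 2)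
       + (- 2 * expect w (fun t => f t * g t)) * (f s * g s)
       + expect w (fun t => f t ^+ 2) * g s ^+ 2).
  apply: eq_expect => s; transitivity (expect w (fun t => f s ^+ 2 * g t ^+ 2
      + (- 2 * (f s * g s)) * (f t * g t) + g s ^+ 2 * f t ^+ 2)).
    by apply: eq_expect => t; ring.
  by rewrite !expectD !expectZ; ring.
rewrite !expectD expectZr !expectZ; lra.
Qed.

End Expectation.

Lemma expect_cauchy_le (R : realType) (T : finType) (w : T -> R) f g (a b : R) :
  is_prob w -> 0 <= a -> 0 <= b ->
  expect w (fun t => f t ^+ 2) <= a ^+ 2 ->
  expect w (fun t => g t ^+ 2) <= b ^+ 2 ->
  expect w (fun t => f t * g t) <= a * b.
Proof.
move=> Pw a0 b0 fa gb; apply: (le_trans (ler_norm _)).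
rewrite -(@ler_pXn2r _ 2)// ?nnegrE ?mulr_ge0// real_normK ?num_real//.
apply: le_trans (expect_cauchy Pw f g) _; rewrite exprMn.
by apply: ler_pM => //; apply: expect_ge0 => // t; exact: sqr_ge0.
Qed.

Section ProductSpace.
Context (R : realType) (n : nat) (Omega : 'I_n -> finType).
Context (w : forall i, Omega i -> R).
Local Notation T := {dffun forall i, Omega i}.

Definition upd (t : T) (i : 'I_n) (a : Omega i) : T :=
  [ffun j => @eqtype.dfwith _ _ t i a j].
Arguments upd t i a : clear implicits.

Lemma upd_in (t : T) i (a : Omega i) : upd t i a i = a.
Proof. by rewrite ffunE eqtype.dfwith_in. Qed.

Lemma upd_out (t : T) i (a : Omega i) j : i != j -> upd t i a j = t j.
Proof. by move=> ij; rewrite ffunE eqtype.dfwith_out. Qed.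

Lemma upd_id (t : T) i : upd t i (t i) = t.
Proof.
by apply/ffunP => j; rewrite ffunE; case: eqtype.dfwithP.
Qed.

Lemma upd_upd (t : T) i (a b : Omega i) : upd (upd t i a) i b = upd t i b.
Proof.
apply/ffunP => j; have [<-|ij] := eqVneq i j; first by rewrite !upd_in.
by rewrite !upd_out.
Qed.

Lemma sum_prod_dffun (F : forall i, Omega i -> R) :
  \sum_(t : T) \prod_i F i (t i) = \prod_i \sum_(a : Omega i) F i a.
Proof.
pose G i : {ffun Omega i -> R} := [ffun a => F i a].
transitivity (\prod_i \sum_(a : Omega i) G i a); last first.
  by apply: eq_bigr => i _; apply: eq_bigr => a _; rewrite ffunE.
under [RHS]eq_bigr => i _ do
  rewrite (big_tag (fun i (a : Omega i) => G i a) i).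
rewrite bigA_distr_big_dep -big_fprod (reindex (@dffun_of_fprod _ _)).
  by apply: eq_bigr => t _; apply: eq_bigr => i _; rewrite !ffunE.
exact/onW_bij/dffun_of_fprod_bij.
Qed.

Lemma expect_prod (F : forall i, Omega i -> R) :
  expect (prod_mass w) (fun t => \prod_i F i (t i))
  = \prod_i expect (@w i) (F i).
Proof.
rewrite /expect /prod_mass.
rewrite -(sum_prod_dffun (fun i a => w a * F i a)).
by apply: eq_bigr => t _; rewrite big_split.
Qed.

Hypothesis Pw : forall i, is_prob (@w i).

Lemma prod_mass_prob : is_prob (prod_mass w).
Proof.
split=> [t|]; first by apply: prodr_ge0 => i _; exact: (Pw i).1.
by rewrite sum_prod_dffun big1// => i _; exact: (Pw i).2.
Qed.

(* Resampling one coordinate preserves the product measure: the map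
   (t, a) |-> (t with i-th coordinate a, t i) is a measure-preserving
   involution. *)
Lemma expect_resample (i : 'I_n) (F : T -> R) :
  expect (prod_mass w) F
  = expect (prod_mass w) (fun t => expect (@w i) (fun a => F (upd t i a))).
Proof.
rewrite /expect.
under [RHS]eq_bigr => t _ do rewrite big_distrr.
rewrite [RHS]pair_bigA /=.
transitivity (\sum_(p : T * Omega i) prod_mass w p.1 * (w p.2 * F p.1)).
  rewrite -(pair_bigA _ (fun t a => prod_mass w t * (w a * F t))) /=.
  apply: eq_bigr => t _; rewrite -big_distrr -big_distrl /=.
  by rewrite (Pw i).2 mul1r.
pose h (p : T * Omega i) : T * Omega i := (upd p.1 i p.2, p.1 i).
have hK : involutive h.
  by case=> t a; rewrite /h /= upd_upd upd_in upd_id.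
rewrite (reindex h); last exact/onW_bij/inv_bij.
apply: eq_bigr => -[t a] _ /=; rewrite !mulrA; congr (_ * _).
rewrite /prod_mass (bigD1 i)//= upd_in [in RHS](bigD1 i)//= mulrAC [RHS]mulrC.
rewrite mulrA; congr (_ * _).
by apply: eq_bigr => j ji; rewrite upd_out// eq_sym.
Qed.

End ProductSpace.
Arguments upd {n Omega} t i a.

(** * Mean value estimate and Taylor bound for the exponential *)

Section ElementaryAnalysis.
Context (R : realType).

Lemma le_of_derive_le (F dF : R -> R) (a b M : R) : a <= b ->
  (forall x, x \in `[a, b] -> derivable F x 1) ->
  (forall x, x \in `]a, b[ -> is_derive x 1 F (dF x)) ->
  (forall x, x \in `]a, b[ -> dF x <= M) -> F b <= F a + M * (b - a).
Proof.
rewrite le_eqVlt => /predU1P[-> *|ab dF1 dF2 dFM].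
  by rewrite subrr mulr0 addr0.
have [c cab ->] : exists2 c, c \in `]a, b[ & F b = F a + dF c * (b - a).
  have [c cab e] := MVT ab dF2 (derivable_within_continuous dF1).
  by exists c => //; rewrite -e; ring.
by rewrite lerD2l ler_wpM2r ?dFM// subr_ge0 ltW.
Qed.

Lemma expR_le_inv1B (u : R) : u < 1 -> expR u <= (1 - u)^-1.
Proof.
move=> u1; rewrite -[u in expR u]opprK expRN lef_pV2 ?posrE ?expR_gt0 ?subr_gt0//.
exact: expR_ge1Dx.
Qed.

Let poly3 (k : R) : {poly R} := Poly [:: 1; 1; 2^-1; k].

Let is_derive_poly3 (k x : R) : is_derive x 1
  (fun u : R => expR u - (poly3 k).[u]) (expR x - (1 + x + 3 * k * x ^+ 2)).
Proof.
have H := is_deriveB (is_derive_expR x) (is_derive_poly (poly3 k) x).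
apply: (is_derive_eq H); congr (_ - _).
rewrite /poly3; have -> : Poly [:: 1; 1; 2^-1; k] =
   1 + 'X + 2^-1 *: 'X^2 + k *: 'X^3 :> {poly R}.
  rewrite /= !cons_poly_def; rewrite mul0r add0r -!mul_polyC; ring.
rewrite !poly.derivE !hornerE /=; lra.
Qed.

(** Comparison of derivatives with [poly3 k]. For nonnegative u, k = 1 works because e^u <= 1 / (1 -
    u); for negative u, k = 0 works because e^u >= 1 + u. *)
Lemma expR_le_taylor2 (u : R) : `|u| <= 1 / 2 ->
  expR u <= 1 + u + u ^+ 2 / 2 + `|u| ^+ 3.
Proof.
have P3 k x : (poly3 k).[x] = 1 + x + x ^+ 2 / 2 + k * x ^+ 3.
  by rewrite /poly3 horner_Poly /=; ring.
have D k x : derivable (fun u => expR u - (poly3 k).[u]) x 1.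
  by case: (is_derive_poly3 k x).
have [u0|u0] := leP 0 u; rewrite ler_norml => /andP[u1 u2].
  have := le_of_derive_le (M := 0) u0 (fun x _ => D 1 x)
    (fun x _ => is_derive_poly3 1 x) _.
  rewrite mul0r addr0 expR0 !P3 => /(_ _)/wrap[].
    move=> x; rewrite in_itv /= => /andP[x0 xu].
    have x1 : x < 1 by lra.
    have := expR_le_inv1B x1.
    suff : (1 - x)^-1 <= 1 + x + 3 * 1 * x ^+ 2 by lra.
    by rewrite -div1r ler_pdivrMr; [nra|lra].
  by rewrite ger0_norm//; lra.
have u0' := ltW u0.
have := le_of_derive_le (F := fun u => - (expR u - (poly3 0).[u])) (M := 0) u0' _
    (fun x _ => is_deriveN (is_derive_poly3 0 x)) _.
rewrite mul0r addr0 expR0 !P3 => /(_ _)/wrap[].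
  by move=> x _; apply: derivableN.
move=> /(_ _)/wrap[].
  by move=> x _; have := expR_ge1Dx x; lra.
by have : 0 <= `|u| ^+ 3 by []; lra.
Qed.

End ElementaryAnalysis.

Definition setc (n : nat) (x : cube n) (i : 'I_n) (b : bool) : cube n :=
  @upd n (fun _ => bool) x i b.

Lemma setc_in n (x : cube n) i b : setc x i b i = b.
Proof. exact: upd_in. Qed.

Lemma setc_out n (x : cube n) i b j : i != j -> setc x i b j = x j.
Proof. exact: upd_out. Qed.

Lemma setc_setc n (x : cube n) i b c : setc (setc x i b) i c = setc x i c.
Proof. exact: upd_upd. Qed.

Lemma expect_exchange (R : realType) (S T : finType) (u : S -> R) (w : T -> R)
    (F : S -> T -> R) :
  expect u (fun s => expect w (F s)) = expect w (fun t => expect u (F^~ t)).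
Proof.
rewrite /expect; under eq_bigr do rewrite big_distrr.
rewrite exchange_big; apply: eq_bigr => t _ /=; rewrite big_distrr.
by apply: eq_bigr => s _; rewrite mulrCA.
Qed.

(** * Random restrictions and the level-1 inequality *)

Section Restriction.
Context (R : realType) (n : nat) (Omega : 'I_n -> finType).
Context (w : forall i, Omega i -> R).
Local Notation T := {dffun forall i, Omega i}.
Hypothesis Pw : forall i, is_prob (@w i).
Variable h : T -> R.

Let Pm : is_prob (prod_mass w) := prod_mass_prob Pw.

Definition restr_mean (x : cube n) (t : T) : R := Vop w h (t, x).
Local Notation v := restr_mean.

(** The change of the conditional mean when the hidden coordinate [i] is revealed with value [a].
    The subtracted term can keep [t]: while [i] is hidden it does not depend on [t i]. *)
Definition incr (x : cube n) (i : 'I_n) (t : T) (a : Omega i) : R :=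
  v (setc x i true) (upd t i a) - v x t.

Lemma mix_upd (x : cube n) i (t t' : T) (a : Omega i) : ~~ x i ->
  mix x t (upd t' i a) = mix (setc x i true) (upd t i a) t'.
Proof.
move=> xi; apply/ffunP => j; rewrite [LHS]ffunE [RHS]ffunE.
have [<-|ij] := eqVneq i j; first by rewrite setc_in !upd_in (negbTE xi).
by rewrite setc_out// !upd_out.
Qed.

Lemma restr_mean_upd (x : cube n) i (t : T) (a : Omega i) : ~~ x i ->
  v x (upd t i a) = v x t.
Proof.
move=> xi; apply: eq_expect => t' /=; congr h; apply/ffunP => j.
rewrite [LHS]ffunE [RHS]ffunE; case: ifP => // xj; rewrite upd_out//.
by apply: contraNneq xi => ->.
Qed.

(** Resample coordinate [i] of the hidden point and exchange the averages. Correlations of [h] with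
    a linear statistic thereby become moments of the increments. *)
Lemma expect_restr_mul (x : cube n) i (t : T) (k : Omega i -> R) : ~~ x i ->
  expect (prod_mass w) (fun t' => h (mix x t t') * k (t' i))
  = expect (@w i) (fun a => v (setc x i true) (upd t i a) * k a).
Proof.
move=> xi; rewrite (expect_resample Pw i) expect_exchange.
apply: eq_expect => a; rewrite -expectZr; apply: eq_expect => t'.
by rewrite mix_upd// upd_in.
Qed.

Lemma expect_incr (x : cube n) i (t : T) : ~~ x i ->
  expect (@w i) (incr x t) = 0.
Proof.
move=> xi; rewrite expectB expect_cst//.
have := expect_restr_mul t (fun _ => 1) xi.
under [in X in X = _]eq_expect => t' do rewrite mulr1.
by under [in X in _ = X]eq_expect => t' do rewrite mulr1; move=> <-; rewrite subrr.
Qed.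

Section LevelOne.
Hypothesis h01 : forall t, 0 <= h t <= 1.
Variables (x : cube n) (t : T) (vt : R).
Hypotheses (v0 : 0 < v x t) (vt0 : 0 < vt) (vtv : 4 * vt <= v x t).

Let g i := @incr x i t.
Let l i (a : Omega i) := if `|g a| <= vt then g a else 0.
Let m i := expect (@w i) (@l i).
Let s i := expect (@w i) (fun a => l a ^+ 2).
(** The strength of the exponential tilt. Entropy duality with a general strength k gives, up to
    truncation errors, (k - v k^2 / 2) S <= v ln(1/v), where S is the sum of the [s i]; k = 1 / v is
    optimal and yields the Gaussian constant 2 v^2 ln(1/v). [B] bounds the logarithm of one factor
    of the moment generating function. *)
Let lam := (v x t)^-1.
Let B i := lam * m i + lam ^+ 2 * s i / 2 * (1 + 2 * (lam * vt)).

Lemma restr_mean_le1 y t0 : v y t0 <= 1.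
Proof.
rewrite -[leRHS](expect_cst Pm); apply: le_expect => // t'.
by case/andP: (h01 (mix y t0 t')).
Qed.

Let lam0 : 0 < lam. Proof. by rewrite invr_gt0. Qed.

Let lamvt : lam * vt <= 1 / 4.
Proof. by rewrite mulrC ler_pdivrMr//; move: (v x t) vtv => V; lra. Qed.

Let l_le i (a : Omega i) : `|l a| <= vt.
Proof. by rewrite /l; case: ifP => [//|_]; rewrite normr0; exact: ltW. Qed.

(* The truncation [l] keeps the exponential moments of the increments Gaussian
   without any loss in [alpha]. *)
Let mgf i : expect (@w i) (fun a => expR (lam * l a)) <= expR (B i).
Proof.
apply: le_trans (expR_ge1Dx _).
have -> : 1 + B i = expect (@w i) (fun a => 1 + lam * l a
    + lam ^+ 2 * (1 + 2 * (lam * vt)) / 2 * l a ^+ 2).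
  by rewrite !expectD expect_cst// !expectZ /B -/(m i) -/(s i); field.
apply: le_expect => // a.
have nl : `|lam * l a| = lam * `|l a| by rewrite normrM gtr0_norm.
have nle : lam * `|l a| <= lam * vt by rewrite ler_wpM2l// ltW.
apply: le_trans (expR_le_taylor2 _) _.
  by rewrite nl; apply: le_trans nle _; apply: le_trans lamvt _; lra.
have -> : lam ^+ 2 * (1 + 2 * (lam * vt)) / 2 * l a ^+ 2 =
  (lam * l a) ^+ 2 / 2 + (lam * vt) * (lam * l a) ^+ 2 by field.
rewrite -addrA lerD2l lerD2l exprS real_normK ?num_real//.
by rewrite nl ler_wpM2r// sqr_ge0.
Qed.

(* The entropy duality [h (1 + X) <= e^X] for [0 <= h <= 1], averaged with
   [X] the log-density of the exponential tilt along the linear part. *)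
Let tilt : \sum_(i | ~~ x i) s i * (1 - 2 * (lam * vt))
  <= 2 * v x t ^+ 2 * - ln (v x t).
Proof.
pose Bs := \sum_(i | ~~ x i) B i.
pose X (t' : T) := lam * (\sum_(i | ~~ x i) l (t' i)) - (Bs - ln (v x t)).
have hX t' : h (mix x t t') * (1 + X t') <= expR (X t').
  case/andP: (h01 (mix x t t')) => h0 h1.
  have [p|q] := leP 0 (1 + X t').
    by apply: le_trans (ler_piMl p h1) _; exact: expR_ge1Dx.
  exact: le_trans (mulr_ge0_le0 h0 (ltW q)) (expR_ge0 _).
have /(le_expect Pm) := hX.
have -> : expect (prod_mass w) (fun t' => h (mix x t t') * (1 + X t'))
   = v x t * (1 - (Bs - ln (v x t)))
     + lam * \sum_(i | ~~ x i) (v x t * m i + s i).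
  transitivity (expect (prod_mass w) (fun t' =>
      h (mix x t t') * (1 - (Bs - ln (v x t)))
      + lam * \sum_(i | ~~ x i) h (mix x t t') * l (t' i))).
    apply: eq_expect => t'; rewrite /X -big_distrr /=.
    ring.
  rewrite expectD expectZr expectZ expect_sum; congr (_ + _ * _).
  apply: eq_bigr => i xi; rewrite expect_restr_mul//.
  have -> : v x t * m i + s i
    = expect (@w i) (fun a => v x t * l a + l a ^+ 2) by rewrite expectD expectZ.
  apply: eq_expect => a.
  rewrite -[v (setc x i true) _](subrK (v x t)) -/(incr x t a) -/(g a).
  by rewrite /l; case: ifP => _; ring.
have -> : expect (prod_mass w) (fun t' => expR (X t'))
   = v x t * expR (- Bs)
     * \prod_i expect (@w i) (fun a => if x i then 1 else expR (lam * l a)).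
  rewrite -expect_prod -expectZ; apply: eq_expect => t'.
  have -> : X t' = ln (v x t) + - Bs + \sum_(i | ~~ x i) lam * l (t' i).
    by rewrite /X -big_distrr /=; ring.
  rewrite !expRD lnK ?posrE// expR_sum big_mkcond; congr (_ * _).
  by apply: eq_bigr => i _; case: (x i).
have prodB : \prod_i expect (@w i) (fun a => if x i then 1 else expR (lam * l a))
    <= expR Bs.
  rewrite /Bs expR_sum [leRHS]big_mkcond /=; apply: ler_prod => i _.
  apply/andP; split.
    by apply: expect_ge0 => // a; case: ifP; rewrite ?expR_ge0.
  by case: (x i) => /=; rewrite ?mgf// expect_cst.
move=> E; have {}E : v x t * (1 - (Bs - ln (v x t)))
     + lam * \sum_(i | ~~ x i) (v x t * m i + s i) <= v x t.
  apply: (le_trans E); rewrite -mulrA; apply: ler_piMr; first exact: ltW.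
  by rewrite expRN [_^-1 * _]mulrC ler_pdivrMr ?expR_gt0// mul1r.
move: E; rewrite big_split -big_distrr /=.
have -> : Bs = lam * (\sum_(i | ~~ x i) m i)
   + lam ^+ 2 / 2 * (1 + 2 * (lam * vt)) * \sum_(i | ~~ x i) s i.
  rewrite /Bs !big_distrr -big_split; apply: eq_bigr => i _ /=.
  by rewrite /B; field.
rewrite -big_distrl /=; set S := \sum_(i | _) s i; set M := \sum_(i | _) m i.
have vl : v x t * lam = 1 by rewrite /lam divff ?gt_eqF.
move=> E; rewrite -(ler_pM2l lam0).
suff e : lam * (S * (1 - 2 * (lam * vt))) - lam * (2 * v x t ^+ 2 * - ln (v x t)) =
  2 * (v x t * (1 - (lam * M + lam ^+ 2 / 2 * (1 + 2 * (lam * vt)) * S - ln (v x t)))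
    + lam * (v x t * M + S) - v x t) by rewrite -subr_le0 e; lra.
have {E} -> : lam * (2 * v x t ^+ 2 * - ln (v x t)) = 2 * v x t * - ln (v x t).
  by transitivity (2 * (v x t * lam) * v x t * - ln (v x t)); [ring|rewrite vl mulr1].
transitivity (2 * (v x t * (1 + ln (v x t)) - (v x t * lam) * M
    - (v x t * lam) * lam / 2 * (1 + 2 * (lam * vt)) * S
    + (v x t * lam) * M + lam * S - v x t)); last by field.
by rewrite vl; field.
Qed.

(** Two corrections to the Gaussian bound. Increments above [vt] satisfy g^2 <= g^4 / vt^2, which
    gives the fourth-moment term. For the truncated sum S, [tilt] reads S (1 - 2 z) <= Y with z = vt
    / v <= 1/4 and Y <= 2; hence S <= 4, and reinserting this gives S <= Y + 8 z. *)
Lemma level_one :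
  \sum_(i | ~~ x i) expect (@w i) (fun a => incr x t a ^+ 2)
  <= 2 * v x t ^+ 2 * - ln (v x t) + 8 * (vt / v x t)
     + (\sum_(i | ~~ x i) expect (@w i) (fun a => incr x t a ^+ 4)) / vt ^+ 2.
Proof.
have gs : \sum_(i | ~~ x i) expect (@w i) (fun a => incr x t a ^+ 2)
  <= \sum_(i | ~~ x i) s i
     + (\sum_(i | ~~ x i) expect (@w i) (fun a => incr x t a ^+ 4)) / vt ^+ 2.
  rewrite big_distrl -big_split; apply: ler_sum => i _ /=.
  rewrite -expectZr -expectD; apply: le_expect => // a; rewrite /l -/(g a).
  have [gl|gl] := leP `|g a| vt.
    by rewrite lerDl mulr_ge0 ?invr_ge0 ?sqr_ge0// exprn_even_ge0.
  rewrite expr0n add0r ler_pdivlMr ?exprn_gt0//.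
  rewrite [leRHS](_ : _ = g a ^+ 2 * g a ^+ 2); last by ring.
  apply: ler_wpM2l; first exact: sqr_ge0.
  by rewrite -[leRHS]real_normK ?num_real// ler_pXn2r ?nnegrE// ltW.
apply: (le_trans gs); rewrite lerD2r.
have S0 : 0 <= \sum_(i | ~~ x i) s i.
  by apply: sumr_ge0 => i _; apply: expect_ge0 => // a; exact: sqr_ge0.
have v1 := restr_mean_le1 x t.
have vln : v x t * - ln (v x t) <= 1.
  have := le_ln1Dx (_ : -1 < lam - 1); rewrite ltrBrDl subrr => /(_ lam0).
  rewrite addrC subrK lnV ?posrE// => le1.
  have vl : v x t * lam = 1 by rewrite /lam divff ?gt_eqF.
  have := ler_wpM2l (ltW v0) le1; rewrite mulrBr vl.
  by move: (v x t * - _) => Z; have := ltW v0; lra.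
have z4 : vt * lam <= 1 / 4 by rewrite mulrC; exact: lamvt.
have T : (\sum_(i | ~~ x i) s i) * (1 - 2 * (vt * lam))
    <= 2 * v x t ^+ 2 * - ln (v x t).
  by rewrite [vt * _]mulrC big_distrl; exact: tilt.
rewrite -/lam; move: S0 z4 T; set S := \sum_(i | _) _.
have : 0 <= vt * lam by rewrite mulr_ge0 ?ltW.
move: (vt * lam) => z z0 S0 z4 T.
have Y2 : 2 * v x t ^+ 2 * - ln (v x t) <= 2.
  rewrite [leLHS](_ : _ = 2 * (v x t * (v x t * - ln (v x t)))); last by ring.
  rewrite ler_piMr// -[leRHS]mulr1; apply: le_trans (ler_wpM2l (ltW v0) vln) _.
  by rewrite mulr1 mulr1.
move: T Y2; move: (2 * v x t ^+ 2 * - ln (v x t)) => Y T Y2.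
have S4 : S <= 4 by nra.
by nra.
Qed.

End LevelOne.
End Restriction.

(** * The capped power potential *)

Section Potential.
Context (R : realType).

(* With [y = v^-a], [potential lam a v] is [y / (1 + lam y)] and
   [potential_slope lam a v] is [y] times the derivative [1 / (1 + lam y)^2];
   the concave cap keeps the potential below [1 / lam]. *)
Definition potential (lam a v : R) : R := (expR (a * ln v) + lam)^-1.
Definition potential_slope (lam a v : R) : R :=
  expR (a * ln v) / (expR (a * ln v) + lam) ^+ 2.

Let log_poly (s : R) := s - s ^+ 2 / 2 - 4 * `|s| ^+ 3.

Let log_poly_bounds (s : R) : `|s| <= 1 / 8 ->
  `|log_poly s| <= 9 / 8 * `|s| /\ log_poly s ^+ 2 <= s ^+ 2 + 3 * `|s| ^+ 3.
Proof.
move=> s8; have s2 : `|s| ^+ 2 = s ^+ 2 by rewrite real_normK ?num_real.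
have [sl sr] : - `|s| <= s /\ s <= `|s|.
  by rewrite ler_norm lerNl -normrN ler_norm.
rewrite /log_poly -s2; have := normr_ge0 s.
move: sl sr s8 s2; move: `|s| => u sl sr u8 us u0; split.
  by rewrite ler_norml; apply/andP; split; nra.
have -> : (s - u ^+ 2 / 2 - 4 * u ^+ 3) ^+ 2 =
   s ^+ 2 - s * (u ^+ 2 + 8 * u ^+ 3) + u ^+ 3 * (u * (1 / 2 + 4 * u) ^+ 2).
  by field.
rewrite -us.
have u3 : 0 <= u ^+ 3 by rewrite exprn_ge0.
have h1 : - s * (u ^+ 2 + 8 * u ^+ 3) <= u * (u ^+ 2 + 8 * u ^+ 3).
  by apply: ler_wpM2r; [have := sqr_ge0 u; lra|lra].
have h3 : (1 / 2 + 4 * u) ^+ 2 <= 1 by rewrite exprn_ile1//; lra.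
have h2 : u ^+ 3 * (u * (1 / 2 + 4 * u) ^+ 2) <= u ^+ 3 * (2 - 8 * u).
  by apply: ler_wpM2l => //; have := ler_wpM2l u0 h3; lra.
by move: h1 h2; lra.
Qed.

(** By exponentiation: the term [- 4 * |s| ^+ 3] of [log_poly] absorbs the cubic errors of its
    square (at most 3/2) and of the Taylor remainder (at most (9/8)^3). *)
Lemma ln_ge_taylor (s : R) : `|s| <= 1 / 8 -> log_poly s <= ln (1 + s).
Proof.
move=> s8; have [q1 q2] := log_poly_bounds s8; have s0 := normr_ge0 s.
have s1 : - `|s| <= s by rewrite lerNl -normrN ler_norm.
rewrite -ler_expR lnK ?posrE; last lra.
apply: le_trans (expR_le_taylor2 _) _; first lra.
have q3 : `|log_poly s| ^+ 3 <= (9 / 8 * `|s|) ^+ 3.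
  by rewrite ler_pXn2r ?nnegrE//; lra.
have s3 : 0 <= `|s| ^+ 3 by apply: exprn_ge0.
by move: q2 q3; rewrite {3}/log_poly exprMn; lra.
Qed.

Lemma potential_bounds (lam a v : R) : 0 < lam ->
  [/\ 0 <= potential lam a v, potential lam a v <= lam^-1,
      0 <= potential_slope lam a v & potential_slope lam a v <= lam^-1].
Proof.
move=> l0; have z0 := expR_gt0 (a * ln v).
rewrite /potential /potential_slope; move: (expR _) z0 => z z0.
have zl : 0 < z + lam by lra.
split; first by rewrite invr_ge0 ltW.
- by rewrite lef_pV2 ?posrE//; lra.
- by apply: divr_ge0; [exact: ltW|apply: exprn_ge0; exact: ltW].
rewrite ler_pdivrMr ?exprn_gt0// mulrC ler_pdivlMr//.
by rewrite expr2; nra.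
Qed.

(* Tangent line bound for the concave function [y / (1 + lam y)]. *)
Lemma potential_concave (lam a v0 v1 : R) : 0 < lam ->
  potential lam a v1 - potential lam a v0
  <= potential_slope lam a v0 * (expR (a * ln v0 - a * ln v1) - 1).
Proof.
move=> l0; rewrite expRB /potential /potential_slope.
have := expR_gt0 (a * ln v0); have := expR_gt0 (a * ln v1).
move: (expR (a * ln v0)) (expR (a * ln v1)) => z0 z1 z1p z0p.
rewrite -subr_ge0.
have -> : z0 / (z0 + lam) ^+ 2 * (z0 / z1 - 1) - ((z1 + lam)^-1 - (z0 + lam)^-1)
  = lam * (z0 - z1) ^+ 2 / ((z0 + lam) ^+ 2 * z1 * (z1 + lam)).
  by field; rewrite !gt_eqF//; lra.
apply: divr_ge0; first by rewrite mulr_ge0 ?sqr_ge0// ltW.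
by rewrite ltW// !mulr_gt0 ?exprn_gt0//; lra.
Qed.

(** For |s| <= 1 / (8 A), the tangent bound reduces the claim to expanding (1 + s)^(-a), whose
    quadratic coefficient is a (a + 1) / 2. For larger s the cubic term dominates by itself: the
    potential and its slope are at most 1 / lam and 1 <= 8 A |s|, which costs 512 + 64 <= 600. *)
Lemma potential_taylor (lam a A v0 v1 : R) (s := (v1 - v0) / v0) :
  0 < lam -> 0 <= a -> a + 1 <= A -> 0 < v0 -> 0 < v1 ->
  potential lam a v1 - potential lam a v0
  <= - a * potential_slope lam a v0 * s
     + a * (a + 1) / 2 * potential_slope lam a v0 * s ^+ 2
     + 600 * A ^+ 3 / lam * `|s| ^+ 3.
Proof.
move=> l0 a0 aA v00 v10.
have [_ _ g0 g1] := potential_bounds a v0 l0.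
have [_ p1 _ _] := potential_bounds a v1 l0.
have [p0 _ _ _] := potential_bounds a v0 l0.
have A1 : 1 <= A by lra.
have A0 : 0 < A by lra.
have s2 : `|s| ^+ 2 = s ^+ 2 by rewrite real_normK ?num_real.
have s0 : 0 <= `|s| by [].
have [sl sr] : - `|s| <= s /\ s <= `|s|.
  by rewrite ler_norm lerNl -normrN ler_norm.
have s3 : 0 <= `|s| ^+ 3 by apply: exprn_ge0.
have A3 : 0 <= A ^+ 3 by rewrite exprn_ge0// ltW.
have [small|big] := leP (`|s|) (1 / (8 * A)); last first.
  have big1 : 1 <= 8 * A * `|s|.
    by move: big; rewrite ltr_pdivrMr ?mulr_gt0// mulrC => /ltW.
  have big2 : 1 <= 64 * A ^+ 2 * `|s| ^+ 2.
    by have := ler_pM ler01 ler01 big1 big1; lra.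
  have big3 : 1 <= 512 * A ^+ 3 * `|s| ^+ 3.
    by have := ler_pM ler01 ler01 big1 big2; lra.
  have il0 : 0 < lam^-1 by rewrite invr_gt0.
  have h1 : lam^-1 <= lam^-1 * (512 * A ^+ 3 * `|s| ^+ 3).
    by rewrite ler_peMr// ltW.
  have h2 : a * potential_slope lam a v0 * s
      <= A * lam^-1 * (`|s| * (64 * A ^+ 2 * `|s| ^+ 2)).
    apply: (le_trans (ler_wpM2l _ sr)); first by rewrite mulr_ge0.
    apply: ler_pM => //; first by rewrite mulr_ge0.
      by apply: ler_pM => //; lra.
    by rewrite ler_peMr.
  have h3 : 0 <= a * (a + 1) / 2 * potential_slope lam a v0 * s ^+ 2.
    apply: mulr_ge0; last exact: sqr_ge0.
    by apply: mulr_ge0 => //; nra.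
  have h4 : 0 <= lam^-1 * (A ^+ 3 * `|s| ^+ 3).
    by rewrite mulr_ge0 ?mulr_ge0// ltW.
  by move: h1 h2 h3 h4; lra.
have s8A : 8 * A * `|s| <= 1.
  by move: small; rewrite ler_pdivlMr ?mulr_gt0// mulrC.
have s8 : `|s| <= 1 / 8 by nra.
have as8 : a * `|s| <= 1 / 8 by nra.
have v1E : ln v1 = ln v0 + ln (1 + s).
  have -> : v1 = v0 * (1 + s) by rewrite /s; field; rewrite gt_eqF.
  by rewrite lnM ?posrE//; lra.
apply: (le_trans (potential_concave a v0 v1 l0)).
have -> : a * ln v0 - a * ln v1 = - (a * ln (1 + s)) by rewrite v1E; ring.
have [qs q2] := log_poly_bounds s8; move: qs q2; set q := log_poly s => qs q2.
have lnq : q <= ln (1 + s) := ln_ge_taylor s8.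
have e1 : expR (- (a * ln (1 + s))) <= expR (- (a * q)).
  by rewrite ler_expR lerN2 ler_wpM2l.
have aq : `|- (a * q)| = a * `|q| by rewrite normrN normrM ger0_norm.
have e2 : expR (- (a * q)) <= 1 - a * q + (a * q) ^+ 2 / 2 + (a * `|q|) ^+ 3.
  have := @expR_le_taylor2 _ (- (a * q)); rewrite aq sqrrN; apply.
  by have := ler_wpM2l a0 qs; lra.
have e3 : a * s + (expR (- (a * ln (1 + s))) - 1)
   <= a * (a + 1) / 2 * s ^+ 2 + 10 * A ^+ 3 * `|s| ^+ 3.
  have q3 : `|q| ^+ 3 <= (9 / 8 * `|s|) ^+ 3.
    by rewrite ler_pXn2r ?nnegrE// mulr_ge0.
  have aX k : a ^+ k <= A ^+ k.
    by apply: lerXn2r; rewrite ?nnegrE; lra.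
  have B1 : a ^+ 3 * `|q| ^+ 3 <= A ^+ 3 * (9 / 8 * `|s|) ^+ 3.
    by apply: ler_pM (aX _) q3; exact: exprn_ge0.
  have B2 : a ^+ 2 * q ^+ 2 <= a ^+ 2 * s ^+ 2 + 3 * A ^+ 3 * `|s| ^+ 3.
    apply: (le_trans (ler_wpM2l (sqr_ge0 a) q2)); rewrite mulrDr lerD2l.
    rewrite mulrCA -mulrA ler_wpM2l// ler_wpM2r//.
    apply: (le_trans (aX 2)); rewrite [leRHS]exprS ler_peMl// sqr_ge0//.
  have B3 : a * `|s| ^+ 3 <= A ^+ 3 * `|s| ^+ 3.
    rewrite ler_wpM2r//; apply: (@le_trans _ _ A); first lra.
    by rewrite ler_eXnr.
  have B4 : 0 <= A ^+ 3 * `|s| ^+ 3 by rewrite mulr_ge0.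
  have aqE : a * q = a * s - a * s ^+ 2 / 2 - 4 * (a * `|s| ^+ 3).
    by rewrite /q /log_poly; ring.
  move: e1 e2 aqE B1 B2; rewrite !exprMn; clearbody q; lra.
have e4 : potential_slope lam a v0 * (a * s + (expR (- (a * ln (1 + s))) - 1))
   <= potential_slope lam a v0 * (a * (a + 1) / 2 * s ^+ 2)
      + lam^-1 * (10 * A ^+ 3 * `|s| ^+ 3).
  apply: (le_trans (ler_wpM2l g0 e3)); rewrite mulrDr lerD2l.
  by apply: ler_wpM2r => //; rewrite mulr_ge0// mulr_ge0.
have e5 : 0 <= lam^-1 * (A ^+ 3 * `|s| ^+ 3).
  by apply: mulr_ge0; [rewrite invr_ge0 ltW|apply: mulr_ge0].
by move: e4 e5; lra.
Qed.

End Potential.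

(** * The reveal process *)

Section Russo.
Context (R : realType).

Lemma is_derive_big_sum (I : Type) (r : seq I) (f : I -> R -> R) (df : I -> R)
    (x : R) : (forall i, is_derive x 1 (f i) (df i)) ->
  is_derive x 1 (fun s => \sum_(i <- r) f i s) (\sum_(i <- r) df i).
Proof.
move=> H; elim: r => [|i r IH].
  rewrite big_nil (_ : (fun s => _) = cst 0); first exact: is_derive_cst.
  by apply/funext => s; rewrite big_nil.
rewrite big_cons (_ : (fun s => _) = f i + (fun s => \sum_(j <- r) f j s)).
  exact: is_deriveD.
by apply/funext => s; rewrite big_cons.
Qed.

Lemma is_derive_big_prod (I : Type) (r : seq I) (f : I -> R -> R) (df : I -> R)
    (x : R) : (forall i, is_derive x 1 (f i) (df i)) -> (forall i, f i x != 0) ->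
  is_derive x 1 (fun s => \prod_(i <- r) f i s)
    ((\prod_(i <- r) f i x) * \sum_(i <- r) df i / f i x).
Proof.
move=> H f0; elim: r => [|i r IH].
  rewrite !big_nil mulr0 (_ : (fun s => _) = cst 1); first exact: is_derive_cst.
  by apply/funext => s; rewrite big_nil.
rewrite !big_cons (_ : (fun s => _) = f i * (fun s => \prod_(j <- r) f j s)).
  apply: (is_derive_eq (is_deriveM (H i) IH)); rewrite /GRing.scale /=.
  by field; exact: f0.
by apply/funext => s; rewrite big_cons.
Qed.

(** At time 0 factors of the cube mass may vanish, so the logarithmic form of the derivative fails
    there. The mean value theorem needs only differentiability at that endpoint. *)
Lemma derivable_big_prod (I : Type) (r : seq I) (f : I -> R -> R) (x : R) :
  (forall i, derivable (f i) x 1) ->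
  derivable (fun s => \prod_(i <- r) f i s) x 1.
Proof.
move=> H; elim: r => [|i r IH].
  rewrite (_ : (fun s => _) = cst 1); first exact: derivable_cst.
  by apply/funext => s; rewrite big_nil.
rewrite (_ : (fun s => _) = f i * (fun s => \prod_(j <- r) f j s)).
  exact: derivableM.
by apply/funext => s; rewrite big_cons.
Qed.

Let is_derive_bernoulli (b : bool) (x : R) :
  is_derive x 1 (fun s => bernoulli_mass s b) (if b then 1 else - 1).
Proof.
case: b; first exact: is_derive_id.
have H := is_deriveB (is_derive_cst (1 : R) x (1 : R)) (is_derive_id x (1 : R)).
by apply: (is_derive_eq H); rewrite sub0r.
Qed.

Lemma derivable_cube_mass n (x : cube n) (s : R) :
  derivable (fun s => cube_mass s x) s 1.
Proof.
by apply: derivable_big_prod => i; case: (is_derive_bernoulli (x i) s).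
Qed.

Lemma bernoulli_prob (s : R) : 0 <= s <= 1 -> is_prob (bernoulli_mass s).
Proof.
case/andP=> s0 s1; split; first by case=> //=; rewrite subr_ge0.
by rewrite big_bool /= addrC subrK.
Qed.

Lemma cube_mass_prob n (s : R) : 0 <= s <= 1 -> is_prob (@cube_mass R n s).
Proof. by move=> s01; apply: prod_mass_prob => i; exact: bernoulli_prob. Qed.

Lemma expect_cube_resample n (i : 'I_n) (s : R) (F : cube n -> R) : 0 <= s <= 1 ->
  expect (cube_mass s) F = expect (cube_mass s)
    (fun x => s * F (setc x i true) + (1 - s) * F (setc x i false)).
Proof.
move=> s01; have P (j : 'I_n) := bernoulli_prob s01.
rewrite /cube_mass (expect_resample P i); apply: eq_expect => x.
by rewrite /expect big_bool.
Qed.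

(* The Russo-Margulis formula. *)
Lemma is_derive_expect_cube n (F : R -> cube n -> R) (dF : cube n -> R) (s : R) :
  0 < s < 1 -> (forall x, is_derive s 1 (F^~ x) (dF x)) ->
  is_derive s 1 (fun s => expect (cube_mass s) (F s))
    (expect (cube_mass s) (fun x => dF x
      + (1 - s)^-1 * \sum_(i | ~~ x i) (F s (setc x i true) - F s x))).
Proof.
case/andP=> s0 s1 HF.
have s01 : 0 <= s <= 1 by rewrite !ltW.
(* The logarithmic derivative of the Bernoulli mass. After resampling coordinate [i], both sides
   become the mean of F with [i] revealed minus F with [i] hidden. *)
pose score (b : bool) : R := (if b then 1 else - 1) / bernoulli_mass s b.
have Hm (x : cube n) : is_derive s 1 (fun s => cube_mass s x)
    (cube_mass s x * \sum_i score (x i)).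
  apply: (is_derive_big_prod _ (fun i => is_derive_bernoulli (x i) s)) => i.
  by case: (x i) => /=; rewrite gt_eqF// subr_gt0.
have H := is_derive_big_sum (index_enum (cube n))
  (fun x => is_deriveM (Hm x) (HF x)).
apply: (is_derive_eq H); rewrite /GRing.scale /=.
transitivity (expect (cube_mass s) (fun x => dF x + \sum_i score (x i) * F s x)).
  apply: eq_bigr => x _; rewrite -big_distrl /=; ring.
rewrite !expectD; congr (_ + _); rewrite expect_sum expectZ.
under [in RHS]eq_expect => x do rewrite big_mkcond.
rewrite expect_sum big_distrr; apply: eq_bigr => i _ /=.
rewrite (expect_cube_resample i _ s01) [in RHS](expect_cube_resample i _ s01).
rewrite -expectZ; apply: eq_expect => x.
rewrite !setc_in !setc_setc /score /=; field.
by rewrite !gt_eqF ?subr_gt0.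
Qed.

End Russo.

Lemma mul_sqr_ln_le (R : realType) (v : R) : 0 < v -> v <= 1 ->
  2 * v ^+ 2 * - ln v <= 2.
Proof.
move=> v0 v1; have iv0 : 0 < v^-1 by rewrite invr_gt0.
have := @le_ln1Dx R (v^-1 - 1); rewrite [1 + _]addrC subrK lnV ?posrE//.
have -> : -1 < v^-1 - 1 by lra.
move=> /(_ isT) le1; have := ler_wpM2l (sqr_ge0 v) le1.
have -> : v ^+ 2 * (v^-1 - 1) = v - v ^+ 2 by field; rewrite gt_eqF.
by have := sqr_ge0 v; lra.
Qed.

(** * Drift of the potential under one reveal *)

Section Drift.
Context (R : realType) (n : nat) (Omega : 'I_n -> finType).
Context (w : forall i, Omega i -> R).
Local Notation T := {dffun forall i, Omega i}.
Hypothesis Pw : forall i, is_prob (@w i).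
Variables (h : T -> R) (eta : R).
Hypotheses (eta0 : 0 < eta) (h_itv : forall t, eta <= h t <= 1).

Local Notation v := (restr_mean w h).
Let Pm : is_prob (prod_mass w) := prod_mass_prob Pw.

Definition jump4 (x : cube n) (t : T) : R :=
  \sum_(i | ~~ x i) expect (@w i) (fun a => incr w h x t a ^+ 4).

Lemma restr_mean_itv (x : cube n) (t : T) : eta <= v x t <= 1.
Proof.
apply/andP; split.
  by rewrite -[leLHS](expect_cst Pm); apply: le_expect => // t';
     case/andP: (h_itv (mix x t t')).
by rewrite -[leRHS](expect_cst Pm); apply: le_expect => // t';
   case/andP: (h_itv (mix x t t')).
Qed.

Variables (lam a A vt : R).
Hypotheses (lam0 : 0 < lam) (a0 : 0 <= a) (aA : a + 1 <= A).
Hypotheses (vt0 : 0 < vt) (vteta : 4 * vt <= eta).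

Local Notation drift_err := (2000 * A ^+ 3 / (lam * eta ^+ 3)).

Let A3 : 0 <= A ^+ 3.
Proof. by apply: exprn_ge0; move: a0 aA; lra. Qed.

Let le3 : 0 < lam * eta ^+ 3.
Proof. by rewrite mulr_gt0// exprn_gt0. Qed.

(** The first-order term averages to zero, since increments have mean zero. The cubic remainder is
    interpolated by |g|^3 <= (vt g^2 + g^4 / vt) / 2, which halves 600 to 300, and v >= eta produces
    the factor 1 / eta^3. *)
Let one_coord (x : cube n) (t : T) i : ~~ x i ->
  expect (@w i) (fun b =>
    potential lam a (v (setc x i true) (upd t i b)) - potential lam a (v x t))
  <= (a * (a + 1) / 2 * potential_slope lam a (v x t) / v x t ^+ 2)
       * expect (@w i) (fun b => incr w h x t b ^+ 2)
     + 300 * A ^+ 3 / (lam * eta ^+ 3)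
       * (vt * expect (@w i) (fun b => incr w h x t b ^+ 2)
          + expect (@w i) (fun b => incr w h x t b ^+ 4) / vt).
Proof.
move=> xi; have /andP[ve v1] := restr_mean_itv x t.
have v0 : 0 < v x t by apply: lt_le_trans ve.
set c1 := _ / v x t ^+ 2; set c2 := _ / (lam * _).
have c20 : 0 <= c2.
  exact: divr_ge0 (mulr_ge0 (ler0n _ _) A3) (ltW le3).
have -> : c1 * expect (@w i) (fun b => incr w h x t b ^+ 2)
    + c2 * (vt * expect (@w i) (fun b => incr w h x t b ^+ 2)
            + expect (@w i) (fun b => incr w h x t b ^+ 4) / vt)
  = expect (@w i) (fun b =>
      (- a * potential_slope lam a (v x t) / v x t) * incr w h x t b
      + (c1 * incr w h x t b ^+ 2
         + c2 * (vt * incr w h x t b ^+ 2 + incr w h x t b ^+ 4 * vt^-1))).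
  rewrite expectD expectZ expect_incr// mulr0 add0r.
  by rewrite expectD !expectZ expectD expectZ expectZr.
apply: le_expect => // b.
have /andP[v1e _] := restr_mean_itv (setc x i true) (upd t i b).
have v10 : 0 < v (setc x i true) (upd t i b) by apply: lt_le_trans v1e.
have := potential_taylor lam0 a0 aA v0 v10; rewrite -/(incr w h x t b).
move: (incr w h x t b) => g /le_trans; apply.
rewrite -addrA; apply: lerD; first by rewrite [g / _]mulrC mulrA.
apply: lerD; first by rewrite /c1 expr_div_n; apply: eq_ler; field; rewrite gt_eqF.
have nv : `|g / v x t| <= `|g| / eta.
  rewrite normrM normfV (gtr0_norm v0) ler_wpM2l// lef_pV2 ?posrE//.
have gq : `|g| ^+ 3 <= (vt * g ^+ 2 + g ^+ 4 * vt^-1) / 2.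
  have -> : g ^+ 4 = (`|g| ^+ 2) ^+ 2 by rewrite real_normK ?num_real// -exprM.
  have -> : g ^+ 2 = `|g| ^+ 2 by rewrite real_normK ?num_real.
  rewrite -subr_ge0.
  have -> : (vt * `|g| ^+ 2 + (`|g| ^+ 2) ^+ 2 * vt^-1) / 2 - `|g| ^+ 3
    = `|g| ^+ 2 * (vt - `|g|) ^+ 2 / (2 * vt) by field; rewrite gt_eqF.
  by apply: divr_ge0 (mulr_ge0 (sqr_ge0 _) (sqr_ge0 _)) _; rewrite mulr_ge0 ?ltW.
have nv3 : `|g / v x t| ^+ 3 <= `|g| ^+ 3 / eta ^+ 3.
  by rewrite -expr_div_n; apply: lerXn2r; rewrite ?nnegrE// divr_ge0// ltW.
have -> : c2 * (vt * g ^+ 2 + g ^+ 4 * vt^-1)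
  = 600 * A ^+ 3 / lam * (((vt * g ^+ 2 + g ^+ 4 * vt^-1) / 2) / eta ^+ 3).
  by rewrite /c2; field; rewrite !gt_eqF// exprn_gt0.
apply: ler_wpM2l.
  exact: divr_ge0 (mulr_ge0 (ler0n _ _) A3) (ltW lam0).
apply: (le_trans nv3); apply: ler_wpM2r gq.
by rewrite invr_ge0; apply: exprn_ge0; exact: ltW.
Qed.

(** The quadratic coefficient a (a + 1) / 2 * slope / v^2 meets the bound 2 v^2 ln(1/v) of
    [level_one], which leaves exactly the main term. The corrections of [level_one] and the
    interpolated cubic terms are collected in the constant 2000. *)
Lemma drift_le (x : cube n) (t : T) :
  \sum_(i | ~~ x i) expect (@w i) (fun b =>
    potential lam a (v (setc x i true) (upd t i b)) - potential lam a (v x t))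
  <= a * (a + 1) * potential_slope lam a (v x t) * - ln (v x t)
     + drift_err * (vt + jump4 x t / vt ^+ 2).
Proof.
have /andP[ve v1] := restr_mean_itv x t.
have v0 : 0 < v x t by apply: lt_le_trans ve.
have h01 t' : 0 <= h t' <= 1.
  by case/andP: (h_itv t') => e ->; rewrite andbT (le_trans (ltW eta0)).
have S1 := level_one Pw h01 v0 vt0 (le_trans vteta ve).
have : \sum_(i | ~~ x i) expect (@w i) (fun b =>
    potential lam a (v (setc x i true) (upd t i b)) - potential lam a (v x t))
  <= (a * (a + 1) / 2 * potential_slope lam a (v x t) / v x t ^+ 2)
       * (\sum_(i | ~~ x i) expect (@w i) (fun b => incr w h x t b ^+ 2))
     + 300 * A ^+ 3 / (lam * eta ^+ 3)
       * (vt * (\sum_(i | ~~ x i) expect (@w i) (fun b => incr w h x t b ^+ 2))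
          + jump4 x t / vt).
  apply: le_trans (ler_sum _ (@one_coord x t)) _.
  rewrite /jump4 !big_split /= -!big_distrr /= big_split /= -big_distrr -big_distrl.
  by [].
move=> /le_trans; apply.
have [_ _ g0 g1] := potential_bounds a (v x t) lam0.
move: S1 g0 g1; rewrite -/(jump4 x t).
have Q0 : 0 <= jump4 x t.
  apply: sumr_ge0 => i _; apply: expect_ge0 => // b.
  by rewrite exprn_even_ge0.
have vl : 2 * v x t ^+ 2 * - ln (v x t) <= 2.
  exact: mul_sqr_ln_le.
have A1 : 1 <= A by move: a0 aA; lra.
move: vl Q0 ve v0 v1; move: (v x t) (jump4 x t) (potential_slope _ _ _).
move=> V Q gp vl Q0 ve V0 V1; set S := \sum_(i | _) _ => S1 g0 g1.
pose k := A ^+ 3 / (lam * eta ^+ 3).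
have k0 : 0 <= k.
  by rewrite divr_ge0// ?mulr_ge0// ?exprn_ge0// ltW//; lra.
have -> : 300 * A ^+ 3 / (lam * eta ^+ 3) = 300 * k.
  by rewrite /k; field; rewrite !gt_eqF// exprn_gt0.
have -> : 2000 * A ^+ 3 / (lam * eta ^+ 3) = 2000 * k.
  by rewrite /k; field; rewrite !gt_eqF// exprn_gt0.
set c1 := _ / V ^+ 2.
have c10 : 0 <= c1.
  apply: divr_ge0 (sqr_ge0 _); apply: mulr_ge0 g0.
  by apply: divr_ge0 => //; apply: mulr_ge0 => //; move: a0; lra.
have c1k : c1 <= k * eta / 2.
  have -> : c1 = a * (a + 1) * gp * (V ^+ 2)^-1 / 2.
    by rewrite /c1; field; rewrite gt_eqF.
  have -> : k * eta / 2 = A ^+ 3 * lam^-1 * (eta ^+ 2)^-1 / 2.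
    by rewrite /k; field; rewrite !gt_eqF.
  apply: ler_wpM2r => //.
  have V2 : (V ^+ 2)^-1 <= (eta ^+ 2)^-1.
    rewrite lef_pV2 ?posrE ?exprn_gt0//.
    by apply: lerXn2r => //; rewrite nnegrE ltW.
  have aa : 0 <= a * (a + 1) by move: a0; nra.
  apply: ler_pM V2; [exact: mulr_ge0|by rewrite invr_ge0 sqr_ge0|].
  apply: (ler_pM aa g0 _ g1); apply: (@le_trans _ _ (A * A)).
    have ap : 0 <= a + 1 by move: a0; lra.
    by apply: (ler_pM a0 ap _ aA); move: aA; lra.
  by rewrite [leRHS]exprS expr2 ler_peMl// -expr2 sqr_ge0.
have vtV : 8 * (vt / V) <= 2.
  by rewrite mulrA ler_pdivrMr//; move: vteta; lra.
have eV : eta / V <= 1 by rewrite ler_pdivrMr// mul1r.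
have vt1 : vt <= 1 by move: vteta; lra.
have Qvt : Q / vt <= Q / vt ^+ 2.
  rewrite ler_wpM2l// lef_pV2 ?posrE ?exprn_gt0//.
  by rewrite expr2 ler_piMl// ltW.
have Q0' : 0 <= Q / vt ^+ 2 by rewrite divr_ge0// sqr_ge0.
have T1 : c1 * S <= a * (a + 1) * gp * - ln V + 4 * k * vt + k * (Q / vt ^+ 2) / 2.
  apply: (le_trans (ler_wpM2l c10 S1)).
  rewrite 2!mulrDr; apply: lerD; first apply: lerD.
  - by apply: eq_ler; rewrite /c1; field; rewrite gt_eqF.
  - have h1 : 0 <= 8 * (vt / V) by rewrite mulr_ge0// divr_ge0// ltW.
    apply: (le_trans (ler_wpM2r h1 c1k)).
    rewrite [leLHS](_ : _ = 4 * k * vt * (eta / V)); last by field; rewrite gt_eqF.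
    by apply: ler_piMr => //; apply: mulr_ge0 (ltW vt0); apply: mulr_ge0.
  - apply: (le_trans (ler_wpM2r Q0' c1k)).
    have : k * eta * (Q / vt ^+ 2) <= k * 1 * (Q / vt ^+ 2).
      by apply: ler_wpM2r => //; apply: ler_wpM2l => //; lra.
    by lra.
have T2 : vt * S <= 4 * vt + Q / vt.
  have -> : 4 * vt + Q / vt = vt * (4 + Q / vt ^+ 2) by field; rewrite gt_eqF.
  by apply: ler_wpM2l; [exact: ltW|lra].
have T3 := ler_wpM2l k0 T2; have T4 := ler_wpM2l k0 Qvt.
have T5 := mulr_ge0 k0 Q0'; have T6 := mulr_ge0 k0 (ltW vt0).
by move: T1 T3 T4 T5 T6; lra.
Qed.

End Drift.

Section Exponent.
Context (R : realType).

(* The solution of [a' = - a (a + 1) / (1 - s)] with [a / (a + 1) = c (1 - s)]. *)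
Definition exponent (c s : R) : R := (1 - c * (1 - s))^-1 - 1.

Variables (c s : R).
Hypotheses (c0 : 0 < c) (c1 : c < 1) (s0 : 0 <= s) (s1 : s < 1).

Let den0 : 0 < 1 - c * (1 - s).
Proof. by move: c0 c1 s0 s1; nra. Qed.

Lemma exponent_ge0 : 0 <= exponent c s.
Proof.
by rewrite subr_ge0 invf_ge1//; move: c0 c1 s0 s1; nra.
Qed.

Lemma exponent_le : exponent c s + 1 <= (1 - c)^-1.
Proof.
by rewrite subrK lef_pV2 ?posrE// ?subr_gt0//; move: c0 c1 s0 s1; nra.
Qed.

Lemma is_derive_exponent : is_derive s 1 (exponent c)
  (- (exponent c s * (exponent c s + 1) / (1 - s))).
Proof.
have gE r : (c *: id + cst (1 - c) : R -> R) r = 1 - c * (1 - r).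
  by transitivity (c * r + (1 - c)); [|ring].
rewrite [X in is_derive _ _ X _](_ : _ =
   (fun s => ((c *: id + cst (1 - c) : R -> R) s)^-1) - cst 1); last first.
  by apply/funext => r; rewrite /exponent -gE.
have H1 := is_deriveD (is_deriveZ c (is_derive_id s (1 : R)))
   (is_derive_cst (1 - c) s (1 : R)).
have g0 : (c *: id + cst (1 - c) : R -> R) s != 0 by rewrite gE gt_eqF.
have H := is_deriveB (is_deriveV g0 H1) (is_derive_cst (1 : R) s (1 : R)).
apply: (is_derive_eq H); rewrite gE /exponent /GRing.scale /=.
by field; rewrite !gt_eqF// subr_gt0.
Qed.

(** This is minus [(1 - s)^-1] times the main term of [drift_le]; the exponent was defined to obtain
    this cancellation. *)
Lemma is_derive_potential (lam v : R) : 0 < lam ->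
  is_derive s 1 (fun s => potential lam (exponent c s) v)
    (potential_slope lam (exponent c s) v * - ln v
     * - (exponent c s * (exponent c s + 1) / (1 - s))).
Proof.
move=> l0; have H1 := is_deriveZ (ln v) is_derive_exponent.
have H2 := is_derive1_comp (is_derive_expR _) H1.
have H3 := is_deriveD H2 (is_derive_cst lam s (1 : R)).
have E r : (expR \o (ln v *: exponent c) + cst lam : R -> R) r
   = expR (exponent c r * ln v) + lam.
  by transitivity (expR (ln v * exponent c r) + lam); [|rewrite mulrC].
have -> : (fun s => potential lam (exponent c s) v) =
   (fun s => ((expR \o (ln v *: exponent c) + cst lam : R -> R) s)^-1).
  by apply/funext => r; rewrite /potential -E.
have p0 : 0 < expR (exponent c s * ln v) + lam by rewrite addr_gt0 ?expR_gt0.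
have g0 : (expR \o (ln v *: exponent c) + cst lam : R -> R) s != 0.
  by rewrite E gt_eqF.
apply: (is_derive_eq (is_deriveV g0 H3)); rewrite E /potential_slope.
rewrite /GRing.scale /= /GRing.scale /= [ln v * _]mulrC addr0.
move: (exponent _ _) p0 => a p0.
by field; rewrite !gt_eqF// subr_gt0.
Qed.

End Exponent.

Section RevealProcess.
Context (R : realType) (n : nat) (Omega : 'I_n -> finType).
Context (w : forall i, Omega i -> R).
Local Notation T := {dffun forall i, Omega i}.
Hypothesis Pw : forall i, is_prob (@w i).
Variables (h : T -> R) (eta : R).
Hypotheses (eta0 : 0 < eta) (h_itv : forall t, eta <= h t <= 1).
Variables (lam c rho vt Gam : R).
Hypotheses (lam0 : 0 < lam) (c0 : 0 < c) (c1 : c < 1).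
Hypotheses (rho0 : 0 < rho) (rho1 : rho < 1).
Hypotheses (vt0 : 0 < vt) (vteta : 4 * vt <= eta).
Hypothesis jump : forall s : R, 0 <= s -> s <= rho ->
  expect (cube_mass s) (fun x => expect (prod_mass w) (jump4 w h x)) <= Gam.

Local Notation v := (restr_mean w h).
Let Pm : is_prob (prod_mass w) := prod_mass_prob Pw.
Let F (s : R) (x : cube n) :=
  expect (prod_mass w) (fun t => potential lam (exponent c s) (v x t)).
Let err : R := 2000 * ((1 - c)^-1) ^+ 3 / (lam * eta ^+ 3).

Let dF (s : R) (x : cube n) := expect (prod_mass w) (fun t =>
  potential_slope lam (exponent c s) (v x t) * - ln (v x t)
    * - (exponent c s * (exponent c s + 1) / (1 - s))).

Let is_derive_F (s : R) (x : cube n) : 0 <= s -> s < 1 ->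
  is_derive s 1 (F^~ x) (dF s x).
Proof.
move=> s0 s1; apply: is_derive_big_sum => t.
have H := is_deriveZ (prod_mass w t) (is_derive_potential c0 c1 s0 s1 (v x t) lam0).
exact: H.
Qed.

(** The time derivative cancels the main term of the drift at every [x], so only the jump error
    remains. [exponent_le] supplies A = 1 / (1 - c), uniformly in [s]. *)
Let generator_le (s : R) (x : cube n) : 0 <= s -> s < 1 ->
  dF s x + (1 - s)^-1 * \sum_(i | ~~ x i) (F s (setc x i true) - F s x)
  <= (1 - s)^-1 * (err * (vt + expect (prod_mass w) (jump4 w h x) / vt ^+ 2)).
Proof.
move=> s0 s1.
have a0 := exponent_ge0 c0 c1 s0 s1.
have aA := exponent_le c0 c1 s0 s1.
have E : \sum_(i | ~~ x i) (F s (setc x i true) - F s x) =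
   expect (prod_mass w) (fun t => \sum_(i | ~~ x i) expect (@w i) (fun b =>
    potential lam (exponent c s) (v (setc x i true) (upd t i b))
      - potential lam (exponent c s) (v x t))).
  rewrite expect_sum; apply: eq_bigr => i _.
  rewrite {1}/F (expect_resample Pw i) -expectB; apply: eq_expect => t.
  by rewrite expectB expect_cst.
have : \sum_(i | ~~ x i) (F s (setc x i true) - F s x) <=
    - (1 - s) * dF s x
    + err * (vt + expect (prod_mass w) (jump4 w h x) / vt ^+ 2).
  rewrite E.
  apply: le_trans (le_expect Pm
    (drift_le Pw eta0 h_itv lam0 a0 aA vt0 vteta x)) _.
  rewrite expectD expectZ expectD expectZr expect_cst// lerD2r.
  rewrite -expectZ; apply: eq_ler; apply: eq_expect => t.
  by field; rewrite subr_eq0 gt_eqF.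
have i0 : 0 < (1 - s)^-1 by rewrite invr_gt0 subr_gt0.
move=> /(ler_wpM2l (ltW i0)); rewrite mulrDr mulrA mulrN mulVf ?subr_eq0 ?gt_eqF//.
by lra.
Qed.

(** At time 0 only the [x] with every coordinate hidden has positive mass, and there the conditional
    mean is the full mean. *)
Lemma expect_cube0 : expect (cube_mass 0) (F 0)
  = potential lam (exponent c 0) (expect (prod_mass w) h).
Proof.
have P0 : is_prob (@cube_mass R n 0) by apply: cube_mass_prob; rewrite lexx ler01.
rewrite -[RHS](expect_cst P0); apply: eq_bigr => x _.
have [x0|] := boolP [forall i, ~~ x i].
  congr (_ * _); rewrite /F -[RHS](expect_cst Pm).
  apply: eq_expect => t; congr potential; apply: eq_expect => t'; congr h.
  by apply/ffunP => i; rewrite ffunE (negbTE (forallP x0 i)).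
rewrite negb_forall => /existsP[i]; rewrite negbK => xi.
have -> : cube_mass 0 x = 0 :> R.
  by rewrite /cube_mass /prod_mass (bigD1 i)//= xi mul0r.
by rewrite !mul0r.
Qed.

(** [generator_le] integrated over the time interval by the mean value theorem. The length [rho] of
    the interval, which multiplies the error, is bounded by 1. *)
Theorem reveal_potential_le :
  expect (cube_mass rho) (fun x => expect (prod_mass w)
    (fun t => potential lam (exponent c rho) (v x t)))
  <= potential lam (exponent c 0) (expect (prod_mass w) h)
     + 2000 * ((1 - c)^-1) ^+ 3 / (lam * eta ^+ 3) * (vt + Gam / vt ^+ 2)
       / (1 - rho).
Proof.
rewrite -expect_cube0 -/err.
pose Psi (s : R) := expect (cube_mass s) (F s).
pose dPsi (s : R) := expect (cube_mass s) (fun x => dF s x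
      + (1 - s)^-1 * \sum_(i | ~~ x i) (F s (setc x i true) - F s x)).
pose M := err * (vt + Gam / vt ^+ 2) / (1 - rho).
have err0 : 0 <= err.
  apply: divr_ge0; last by rewrite ltW// mulr_gt0// exprn_gt0.
  apply: mulr_ge0 (ler0n _ _) _; apply: exprn_ge0.
  by rewrite invr_ge0 subr_ge0 ltW.
have Gam0 : 0 <= Gam.
  have P0 : is_prob (@cube_mass R n 0) by apply: cube_mass_prob; rewrite lexx ler01.
  apply: le_trans (jump (lexx 0) (ltW rho0)).
  apply: expect_ge0 => // x; apply: expect_ge0 => // t.
  apply: sumr_ge0 => i _; apply: expect_ge0 => // b.
  by rewrite exprn_even_ge0.
have M0 : 0 <= err * (vt + Gam / vt ^+ 2).
  by apply: mulr_ge0 => //; apply: addr_ge0 (ltW vt0) _; rewrite divr_ge0// sqr_ge0.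
have := @le_of_derive_le R Psi dPsi 0 rho M (ltW rho0).
have H1 x : x \in `[0, rho] -> derivable Psi x 1.
  rewrite in_itv /= => /andP[x0 xr].
  have x1 : x < 1 := le_lt_trans xr rho1.
  have D y : derivable (fun s => cube_mass s y * F s y) x 1.
    apply: derivableM; first exact: derivable_cube_mass.
    by case: (is_derive_F y x0 x1).
  by case: (is_derive_big_sum (index_enum (cube n)) (fun y => derivableP (D y))).
have H2 x : x \in `]0, rho[ -> is_derive x 1 Psi (dPsi x).
  rewrite in_itv /= => /andP[x0 xr].
  have x1 : x < 1 := lt_trans xr rho1.
  apply: is_derive_expect_cube; first by rewrite x0.
  by move=> y; exact: is_derive_F (ltW x0) x1.
have H3 x : x \in `]0, rho[ -> dPsi x <= M.
  rewrite in_itv /= => /andP[x0 xr].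
  have x1 : x < 1 := lt_trans xr rho1.
  have Px : is_prob (@cube_mass R n x) by apply: cube_mass_prob; rewrite !ltW.
  apply: (le_trans (le_expect Px (fun y => generator_le y (ltW x0) x1))).
  rewrite expectZ expectZ expectD expect_cst// expectZr /M [leRHS]mulrC.
  apply: ler_pM.
  - by rewrite invr_ge0 subr_ge0 ltW.
  - apply: mulr_ge0 => //; apply: addr_ge0 (ltW vt0) _; rewrite divr_ge0 ?sqr_ge0//.
    apply: expect_ge0 => // y; apply: expect_ge0 => // t.
    apply: sumr_ge0 => i _; apply: expect_ge0 => // b.
    by rewrite exprn_even_ge0.
  - by rewrite lef_pV2 ?posrE ?subr_gt0// lerD2l lerN2 ltW.
  - apply: ler_wpM2l => //; rewrite lerD2l ler_wpM2r ?invr_ge0 ?sqr_ge0//.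
    exact: jump (ltW x0) (ltW xr).
move=> /(_ H1 H2 H3); rewrite subr0 => /le_trans; apply.
rewrite lerD2l; apply: ler_piMr (ltW rho1).
by apply: divr_ge0 => //; rewrite subr_ge0 ltW.
Qed.

End RevealProcess.

(** * Bonami's inequality and the size of the jumps *)

Section Fourier.
Context (R : realType) (n : nat) (Omega : 'I_n -> finType).
Context (w : forall i, Omega i -> R).
Local Notation T := {dffun forall i, Omega i}.
Hypothesis Pw : forall i, is_prob (@w i).
Context (m : 'I_n -> nat) (X : forall i, 'I_(m i).+1 -> Omega i -> R).
Hypothesis HX : forall i, orthonormal_basis1 (@w i) (@X i).

Let Pm : is_prob (prod_mass w) := prod_mass_prob Pw.

Definition fourier_sum (c : mindex m -> R) (t : T) : R :=
  \sum_(s : mindex m) c s * \prod_i X (s i) (t i).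

Lemma expect_basis i (j : 'I_(m i).+1) : expect (@w i) (X j) = (j == ord0)%:R.
Proof.
have [X0 XX _] := HX i; rewrite -XX.
by apply: eq_expect => a; rewrite X0 mulr1.
Qed.

Lemma parseval (c : mindex m -> R) :
  expect (prod_mass w) (fun t => fourier_sum c t ^+ 2) = \sum_s c s ^+ 2.
Proof.
have orth (s s' : mindex m) : expect (prod_mass w) (fun t =>
    (\prod_i X (s i) (t i)) * \prod_i X (s' i) (t i)) = (s == s')%:R.
  under eq_expect => t do rewrite -big_split.
  rewrite (expect_prod w (fun i a => X (s i) a * X (s' i) a)).
  have [<-|ss'] := eqVneq s s'.
    by rewrite big1// => i _; have [_ -> _] := HX i; rewrite eqxx.
  have [i si] : exists i, s i != s' i.
    apply/existsP; rewrite -negb_forall; apply: contra ss' => /forallP H.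
    by apply/eqP/ffunP => i; apply/eqP.
  by rewrite (bigD1 i)//=; have [_ -> _] := HX i; rewrite (negbTE si) mul0r.
transitivity (expect (prod_mass w) (fun t => \sum_s \sum_s' c s * c s' *
   ((\prod_i X (s i) (t i)) * \prod_i X (s' i) (t i)))).
  apply: eq_expect => t; rewrite expr2 /fourier_sum big_distrl.
  apply: eq_bigr => s _ /=; rewrite big_distrr; apply: eq_bigr => s' _ /=.
  by rewrite mulrACA.
rewrite expect_sum; apply: eq_bigr => s _; rewrite expect_sum.
rewrite (bigD1 s)//= expectZ orth eqxx mulr1 big1 ?addr0 ?expr2// => s' ss'.
by rewrite expectZ orth eq_sym (negbTE ss') mulr0.
Qed.

Section Bonami.
Variables (alpha : R).
Hypotheses (alpha0 : 0 < alpha) (alpha1 : alpha <= 1 / 2).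
Hypothesis (alpha_le : forall i (a : Omega i), alpha <= w a).
Let beta := 4 / alpha.

(** The quartic A^4 + 4 A^3 B + 8 A^2 B^2 + 3 B^4 exceeds (A + B)^4 by 2 B^2 (A - B)^2, and its term
    linear in B averages to zero. Atoms of mass at least [alpha] give B^2 <= b / alpha pointwise,
    hence E B^4 <= b^2 / alpha; [beta] = 4 / alpha covers both resulting terms. *)
Lemma bonami1 i (A : R) (B : Omega i -> R) : expect (@w i) B = 0 ->
  expect (@w i) (fun a => (A + B a) ^+ 4)
  <= (A ^+ 2 + beta * expect (@w i) (fun a => B a ^+ 2)) ^+ 2.
Proof.
move=> B0; set b := expect _ (fun a => B a ^+ 2).
have b0 : 0 <= b by apply: expect_ge0 => // a; exact: sqr_ge0.
have Bb a : B a ^+ 2 <= b / alpha.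
  rewrite ler_pdivlMr// /b /expect (bigD1 a)//= mulrC.
  apply: ler_wpDr; last by apply: ler_wpM2r => //; exact: sqr_ge0.
  by apply: sumr_ge0 => a' _; apply: mulr_ge0 (sqr_ge0 _); exact: (Pw i).1.
have B4 : expect (@w i) (fun a => B a ^+ 4) <= b ^+ 2 / alpha.
  rewrite [leRHS](_ : _ = b * (b / alpha)); last by ring.
  rewrite -[b * _]expectZr; apply: le_expect => // a.
  have -> : B a ^+ 4 = B a ^+ 2 * B a ^+ 2 by ring.
  by apply: ler_wpM2l (Bb a); exact: sqr_ge0.
apply: (@le_trans _ _ (A ^+ 4 + 8 * A ^+ 2 * b + 3 * (b ^+ 2 / alpha))).
  apply: (@le_trans _ _ (expect (@w i) (fun a => A ^+ 4 + 4 * A ^+ 3 * B a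
     + 8 * A ^+ 2 * B a ^+ 2 + 3 * B a ^+ 4))).
    apply: le_expect => // a; rewrite -subr_ge0.
    rewrite [leRHS](_ : _ = 2 * (B a * (A - B a)) ^+ 2); last by ring.
    by rewrite mulr_ge0 ?sqr_ge0.
  by rewrite !expectD expect_cst// !expectZ B0 mulr0 addr0 -/b; lra.
have i2 : 2 <= alpha^-1.
  by rewrite -[leLHS]invrK lef_pV2 ?posrE//; move: alpha1; lra.
rewrite sqrrD -exprM exprMn /beta.
have b2 : 0 <= b ^+ 2 by exact: sqr_ge0.
have Ab : 0 <= A ^+ 2 * b by apply: mulr_ge0 b0; exact: sqr_ge0.
move: i2; move: alpha^-1 => r r2.
rewrite -addrA -[leRHS]addrA lerD2l; apply: lerD.
  have -> : (A ^+ 2 * (4 * r * b)) *+ 2 = (8 * r) * (A ^+ 2 * b) by ring.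
  by have := ler_wpM2r Ab r2; lra.
rewrite [leRHS](_ : _ = 16 * r * (b ^+ 2 * r)); last by ring.
have h : 0 <= b ^+ 2 * r by apply: mulr_ge0 => //; lra.
by have := ler_wpM2r h r2; lra.
Qed.

Let updm (s : mindex m) i (l : 'I_(m i).+1) : mindex m :=
  @upd n (fun i => 'I_(m i).+1) s i l.

Lemma sum_mindex_fiber i (F : mindex m -> R) :
  \sum_s F s = \sum_(l < (m i).+1) \sum_(s : mindex m | s i == ord0) F (updm s l).
Proof.
rewrite (partition_big (fun s : mindex m => s i) xpredT)//=.
apply: eq_bigr => l _.
rewrite (reindex_onto (fun s => @updm s i l) (fun s => @updm s i ord0)).
  apply: eq_bigl => s; rewrite /updm upd_in eqxx upd_upd /=.
  apply/eqP/eqP => [<-|<-]; first by rewrite upd_in.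
  by rewrite upd_id.
by move=> s /eqP <-; rewrite /updm upd_upd upd_id.
Qed.

Lemma mdegree_upd (s : mindex m) i (l : 'I_(m i).+1) : s i = ord0 ->
  mdegree (updm s l) = ((0 < l) + mdegree s)%N.
Proof.
move=> si; rewrite /mdegree -!sum1_card [LHS]big_mkcond (bigD1 i)//=.
rewrite [X in _ = (_ + X)%N]big_mkcond [X in _ = (_ + X)%N](bigD1 i)//=.
rewrite !inE /updm upd_in si add0n.
congr (_ + _)%N.
by apply: eq_bigr => j ji; rewrite !inE upd_out// eq_sym.
Qed.

(** Coefficients of the function multiplying [X l] when the i-th variable is separated. Extension by
    0 keeps them on the same index set, which allows induction without changing the product
    space. *)
Let coef_fiber (c : mindex m -> R) i (l : 'I_(m i).+1) (s : mindex m) : R :=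
  if s i == ord0 then c (updm s l) else 0.

Lemma fourier_sum_upd (c : mindex m -> R) i t (b : Omega i) :
  fourier_sum c (upd t i b) =
  \sum_(l < (m i).+1) X l b * fourier_sum (coef_fiber c l) t.
Proof.
rewrite /fourier_sum (sum_mindex_fiber i); apply: eq_bigr => l _.
rewrite big_distrr [RHS](bigID (fun s : mindex m => s i == ord0)) /=.
rewrite [X in _ = _ + X]big1 ?addr0; last first.
  by move=> s /negbTE si; rewrite /coef_fiber si mul0r mulr0.
apply: eq_bigr => s si; rewrite /coef_fiber si mulrCA; congr (_ * _).
rewrite (bigD1 i)//= [in RHS](bigD1 i)//= /updm !upd_in; congr (_ * _).
have [X0 _ _] := HX i; rewrite (eqP si) X0 mul1r.
by apply: eq_bigr => j ji; rewrite !upd_out// eq_sym.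
Qed.

Let wnorm (c : mindex m -> R) := \sum_s beta ^+ mdegree s * c s ^+ 2.

Let beta0 : 0 < beta. Proof. by rewrite divr_gt0. Qed.

Let wnorm_ge0 c : 0 <= wnorm c.
Proof.
by apply: sumr_ge0 => s _; apply: mulr_ge0 (sqr_ge0 _); apply: exprn_ge0; apply: ltW.
Qed.

(** [bonami1] in the i-th variable bounds the conditional fourth moment by the square of a sum of
    weighted squares [U l]; the triangle inequality in L^2, through Cauchy-Schwarz on cross terms,
    then brings in the fourth moments of the fibers. *)
Let bonami_step (c : mindex m -> R) i :
  (forall l : 'I_(m i).+1, expect (prod_mass w)
     (fun t => fourier_sum (coef_fiber c l) t ^+ 4) <= wnorm (coef_fiber c l) ^+ 2) ->
  expect (prod_mass w) (fun t => fourier_sum c t ^+ 4) <= wnorm c ^+ 2.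
Proof.
move=> IH; pose G (l : 'I_(m i).+1) (t : T) := fourier_sum (coef_fiber c l) t.
pose U (l : 'I_(m i).+1) (t : T) := beta ^+ (0 < l)%N * G l t ^+ 2.
rewrite (expect_resample Pw i).
apply: (@le_trans _ _ (expect (prod_mass w)
    (fun t => (\sum_(l < (m i).+1) U l t) ^+ 2))).
  apply: le_expect => // t.
  pose B (b : Omega i) := \sum_(l < m i) X (lift ord0 l) b * G (lift ord0 l) t.
  have BE b : fourier_sum c (upd t i b) = G ord0 t + B b.
    rewrite fourier_sum_upd big_ord_recl -/(B b).
    by have [-> _ _] := HX i; rewrite mul1r.
  under eq_expect => b do rewrite BE.
  apply: le_trans (bonami1 _ _) _.
    rewrite /B expect_sum big1// => l _; rewrite expectZr expect_basis.
    by rewrite mul0r.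
  have -> : expect (@w i) (fun b => B b ^+ 2)
    = \sum_(l < m i) G (lift ord0 l) t ^+ 2.
    transitivity (expect (@w i) (fun b => \sum_(l < m i) \sum_(k < m i)
      G (lift ord0 l) t * G (lift ord0 k) t
         * (X (lift ord0 l) b * X (lift ord0 k) b))).
      apply: eq_expect => b; rewrite /B expr2 big_distrl.
      apply: eq_bigr => l _ /=; rewrite big_distrr; apply: eq_bigr => k _ /=; ring.
    rewrite expect_sum; apply: eq_bigr => l _; rewrite expect_sum (bigD1 l)//=.
    have [_ orth _] := HX i.
    rewrite expectZ orth eqxx mulr1 big1 ?addr0 ?expr2// => k kl.
    by rewrite expectZ orth (inj_eq lift_inj) eq_sym (negbTE kl) mulr0.
  rewrite big_ord_recl {1}/U /= expr0 mul1r.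
  by rewrite big_distrr.
have -> : wnorm c = \sum_(l < (m i).+1) beta ^+ (0 < l)%N * wnorm (coef_fiber c l).
  rewrite /wnorm (sum_mindex_fiber i); apply: eq_bigr => l _.
  rewrite big_distrr [RHS](bigID (fun s : mindex m => s i == ord0)) /=.
  rewrite [X in _ = _ + X]big1 ?addr0; last first.
    by move=> s /negbTE si; rewrite /coef_fiber si expr0n !mulr0.
  apply: eq_bigr => s si; rewrite /coef_fiber si mdegree_upd; last exact/eqP.
  by rewrite exprD mulrA.

pose u (l : 'I_(m i).+1) := beta ^+ (0 < l)%N * wnorm (coef_fiber c l).
have u0 l : 0 <= u l.
  by apply: mulr_ge0 (wnorm_ge0 _); apply: exprn_ge0; apply: ltW.
have Uu l : expect (prod_mass w) (fun t => U l t ^+ 2) <= u l ^+ 2.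
  rewrite /u exprMn; apply: le_trans (ler_wpM2l (sqr_ge0 _) (IH l)).
  rewrite -expectZ; apply: eq_ler; apply: eq_expect => t.
  by rewrite /U exprMn; congr (_ * _); rewrite -exprM.
rewrite [leRHS]expr2 big_distrl /=.
rewrite (_ : expect _ _ =
    \sum_l \sum_k expect (prod_mass w) (fun t => U l t * U k t)).
  apply: ler_sum => l _; rewrite big_distrr; apply: ler_sum => k _.
  exact: expect_cauchy_le Pm (u0 l) (u0 k) (Uu l) (Uu k).
transitivity (expect (prod_mass w) (fun t => \sum_l \sum_k U l t * U k t)).
  apply: eq_expect => t; rewrite expr2 big_distrl; apply: eq_bigr => l _.
  by rewrite big_distrr.
by rewrite expect_sum; apply: eq_bigr => l _; rewrite expect_sum.
Qed.

Theorem bonami (c : mindex m -> R) :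
  expect (prod_mass w) (fun t => fourier_sum c t ^+ 4)
  <= (\sum_s beta ^+ mdegree s * c s ^+ 2) ^+ 2.
Proof.
(* Induction on the number of active coordinates: [d] is supported on multi-indices that vanish at
   every coordinate from [k] on. Splitting off coordinate [k] leaves fibers supported below [k]. *)
suff H k (d : mindex m -> R) :
    (forall s : mindex m,
       [exists i : 'I_n, (k <= i)%N && (s i != ord0)] -> d s = 0) ->
    expect (prod_mass w) (fun t => fourier_sum d t ^+ 4) <= wnorm d ^+ 2.
  by apply: (H n) => s /existsP[i]; rewrite leqNgt ltn_ord.
elim: k d => [|k IH] d supp.
  pose z : mindex m := [ffun i => ord0].
  have dz s : s != z -> d s = 0.
    move=> sz; apply: supp; apply: contraR sz; rewrite negb_exists => /forallP H.
    apply/eqP/ffunP => i; rewrite ffunE.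
    by have := H i; rewrite leq0n /= negbK => /eqP.
  have -> : expect (prod_mass w) (fun t => fourier_sum d t ^+ 4) = (d z ^+ 2) ^+ 2.
    rewrite -exprM -(expect_cst Pm (d z ^+ 4)); apply: eq_expect => t; congr (_ ^+ 4).
    rewrite /fourier_sum (bigD1 z)//= [X in _ + X]big1 ?addr0; last first.
      by move=> s /dz ->; rewrite mul0r.
    rewrite big1 ?mulr1// => i _; rewrite ffunE.
    by have [-> _ _] := HX i.
  apply: lerXn2r; rewrite ?nnegrE ?sqr_ge0 ?wnorm_ge0//.
  rewrite /wnorm (bigD1 z)//= [X in _ <= _ + X]big1 ?addr0; last first.
    by move=> s /dz ->; rewrite expr0n mulr0.
  rewrite (_ : mdegree z = 0%N) ?expr0 ?mul1r//.
  by apply: eq_card0 => i; rewrite !inE ffunE.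
have [kn|nk] := ltnP k n; last first.
  apply: IH => s /existsP[i]; rewrite leqNgt (leq_trans (ltn_ord i) nk) //.
pose i := Ordinal kn.
apply: (@bonami_step d i) => l; apply: IH => s /existsP[j /andP[kj sj]].
rewrite /coef_fiber; case: eqP => // si; apply: supp; apply/existsP; exists j.
have ij : i != j by apply: contraNneq sj => <-; rewrite si.
rewrite /updm upd_out// sj andbT ltn_neqAle kj andbT.
by apply: contraNneq ij => kj'; apply/eqP/val_inj.
Qed.

End Bonami.
End Fourier.

(** * Fourth moments of the jumps from low-degree influences *)

Section JumpBound.
Context (R : realType) (n : nat) (Omega : 'I_n -> finType).
Context (w : forall i, Omega i -> R).
Local Notation T := {dffun forall i, Omega i}.
Hypothesis Pw : forall i, is_prob (@w i).
Context (m : 'I_n -> nat) (X : forall i, 'I_(m i).+1 -> Omega i -> R).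
Hypothesis HX : forall i, orthonormal_basis1 (@w i) (@X i).
Variables (f : T -> R) (c : mindex m -> R).
Hypotheses (f01 : forall t, 0 <= f t <= 1) (fc : is_expansion X f c).

Let Pm : is_prob (prod_mass w) := prod_mass_prob Pw.

Let ord0_pos k (j : 'I_k.+1) : (j == ord0) = ~~ (0 < j)%N.
Proof. by rewrite -leqNgt leqn0 -val_eqE. Qed.

Lemma restr_mean_fourier (x : cube n) (t : T) : restr_mean w f x t =
  \sum_(s : mindex m) c s *
    \prod_i (if x i then X (s i) (t i) else (~~ (0 < s i)%N)%:R).
Proof.
transitivity (expect (prod_mass w) (fun t' => \sum_(s : mindex m) c s *
    \prod_i (if x i then X (s i) (t i) else X (s i) (t' i)))).
  apply: eq_expect => t'; rewrite fc; apply: eq_bigr => s _; congr (_ * _).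
  by apply: eq_bigr => i _; rewrite ffunE /=; case: (x i).
rewrite expect_sum; apply: eq_bigr => s _; rewrite expectZ; congr (_ * _).
rewrite (expect_prod w (fun i a => if x i then X (s i) (t i) else X (s i) a)).
apply: eq_bigr => i _; case: (x i); first by rewrite expect_cst.
by rewrite (expect_basis HX) ord0_pos.
Qed.

(* Given that i is unrevealed, the characters that enter the conditional mean
   when i is revealed. *)
Definition boundary (x : cube n) (i : 'I_n) (s : mindex m) : bool :=
  (0 < s i)%N && [forall j, (0 < s j)%N ==> (x j || (j == i))].

(** A character survives in the conditional mean exactly when all its active coordinates are
    revealed, so the difference keeps those that need [i]. Evaluation at [upd t i b] lets
    [expect_resample] merge the averages over [t] and [b]. *)
Lemma incr_fourier (x : cube n) i (t : T) (b : Omega i) : ~~ x i ->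
  incr w f x t b
  = fourier_sum X (fun s => if boundary x i s then c s else 0) (upd t i b).
Proof.
move=> xi; rewrite /incr -(restr_mean_upd w f t b xi) !restr_mean_fourier.
rewrite -sumrB; apply: eq_bigr => s _; rewrite -mulrBr.
set u := upd t i b.
have X1 j : (0 < s j)%N = false -> X (s j) (u j) = 1.
  by move=> /negbT; rewrite -ord0_pos => /eqP ->; have [-> _ _] := HX j.
have e j : j != i -> (if setc x i true j then X (s j) (u j) else (~~ (0 < s j)%N)%:R)
   = (if x j then X (s j) (u j) else (~~ (0 < s j)%N)%:R).
  by move=> ji; rewrite setc_out// eq_sym.
rewrite (bigD1 i)//= [X in _ - X](bigD1 i)//= setc_in (negbTE xi) (eq_bigr _ e).
rewrite -mulrBl /boundary.
have [si|si] /= := boolP (0 < s i)%N; last first.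
  by rewrite X1 ?subrr ?mul0r ?mulr0//; apply/negbTE.
rewrite subr0; case: forallP => [H|/forallP].
  congr (_ * _); rewrite [RHS](bigD1 i)//=; congr (_ * _).
  apply: eq_bigr => j ji; have := H j; rewrite (negbTE ji) orbF.
  by case: (x j) => //; case E: (0 < s j)%N => //= _; rewrite X1.
rewrite negb_forall => /existsP[j]; rewrite negb_imply => /andP[sj].
rewrite negb_or => /andP[xj ji].
by rewrite (bigD1 j)//= (negbTE xj) sj /= mul0r !mulr0 mul0r.
Qed.

Variables (alpha d Bd : R).
Hypotheses (alpha0 : 0 < alpha) (alpha1 : alpha <= 1 / 2).
Hypothesis (alpha_le : forall i (a : Omega i), alpha <= w a).
Hypothesis d0 : 0 <= d.
Hypothesis Bd_ge : forall k : nat, k%:R <= d -> (4 / alpha) ^+ k <= Bd.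

(* [L] and [H] are the low- and high-degree parts of a bounded increment, the
   latter small in L^2 only. *)
Let pow4_split (L H : R) : `|L + H| <= 1 ->
  (L + H) ^+ 4 <= 16 * L ^+ 4 + 4 * H ^+ 2.
Proof.
move=> u1; have u2 : (L + H) ^+ 2 <= 1.
  by rewrite -real_normK ?num_real// exprn_ile1.
have uu : (L + H) ^+ 2 <= 2 * L ^+ 2 + 2 * H ^+ 2.
  by have := sqr_ge0 (L - H); lra.
have -> : (L + H) ^+ 4 = (L + H) ^+ 2 * (L + H) ^+ 2 by ring.
have -> : L ^+ 4 = L ^+ 2 * L ^+ 2 by ring.
have := sqr_ge0 L; have := sqr_ge0 H; have := sqr_ge0 (L + H).
move: ((L + H) ^+ 2) (L ^+ 2) (H ^+ 2) u2 uu => u l h' u2 uu u0 h0 l0.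
by have [hl|lh] := leP h' l; nra.
Qed.

Let Bd0 : 0 <= Bd.
Proof. by apply: le_trans (Bd_ge (k := 0) d0). Qed.

Let low_inf_ge0 i : 0 <= low_inf c d i.
Proof. by apply: sumr_ge0 => s _; exact: sqr_ge0. Qed.

(** Bonami's inequality handles degrees up to [d], where its weight is at most [Bd]. Above [d] that
    weight is uncontrolled, so only Parseval is used. *)
Let coord_bound (x : cube n) i : ~~ x i ->
  expect (prod_mass w) (fun t => expect (@w i) (fun b => incr w f x t b ^+ 4))
  <= 16 * (Bd * low_inf c d i) ^+ 2
     + 4 * \sum_(s : mindex m | ~~ ((mdegree s)%:R <= d))
             c s ^+ 2 * (boundary x i s)%:R.
Proof.
move=> xi.
pose aL (s : mindex m) := if boundary x i s && ((mdegree s)%:R <= d) then c s else 0.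
pose aH (s : mindex m) :=
  if boundary x i s && ~~ ((mdegree s)%:R <= d) then c s else 0.
have split t b : incr w f x t b
    = fourier_sum X aL (upd t i b) + fourier_sum X aH (upd t i b).
  rewrite incr_fourier// /fourier_sum -big_split; apply: eq_bigr => s _ /=.
  rewrite -mulrDl /aL /aH; case: boundary => /=; last by rewrite addr0.
  by case: (_ <= d); rewrite /= ?addr0 ?add0r.
apply: (@le_trans _ _ (expect (prod_mass w) (fun t => expect (@w i) (fun b =>
   16 * fourier_sum X aL (upd t i b) ^+ 4 + 4 * fourier_sum X aH (upd t i b) ^+ 2)))).
  apply: le_expect => // t; apply: le_expect => // b.
  rewrite split; apply: pow4_split; rewrite -split /incr.
  have /andP[p1 p2] := restr_mean_itv Pw f01 x t.
  have /andP[q1 q2] := restr_mean_itv Pw f01 (setc x i true) (upd t i b).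
  by rewrite ler_norml; apply/andP; split; lra.
rewrite -(expect_resample Pw i (fun t => 16 * fourier_sum X aL t ^+ 4
   + 4 * fourier_sum X aH t ^+ 2)) expectD !expectZ; apply: lerD.
  apply: ler_wpM2l => //; apply: (le_trans (bonami Pw HX alpha0 alpha1 alpha_le aL)).
  have b0 : 0 <= 4 / alpha by rewrite divr_ge0// ltW.
  apply: lerXn2r; rewrite ?nnegrE.
  - by apply: sumr_ge0 => s _; apply: mulr_ge0 (sqr_ge0 _); exact: exprn_ge0.
  - exact: mulr_ge0.
  - rewrite /low_inf big_distrr /= [leRHS]big_mkcond; apply: ler_sum => s _.
    rewrite /aL /boundary andbC andbA; case: ifP => [/andP[sd _]|].
      by rewrite sd; apply: ler_wpM2r (Bd_ge _); rewrite ?sqr_ge0//; case/andP: sd.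
    rewrite expr0n mulr0; case: ifP => // /andP[sd _] _.
    apply: mulr_ge0 (sqr_ge0 _); apply: le_trans (Bd_ge sd); exact: exprn_ge0.
rewrite parseval// ler_wpM2l// [leRHS]big_mkcond; apply: ler_sum => s _.
rewrite /aH; case: boundary; case: (_ <= d) => /=;
  rewrite ?expr0n ?mulr1 ?mulr0 ?sqr_ge0//.
Qed.

Let sum_sqr : \sum_s c s ^+ 2 <= 1.
Proof.
rewrite -(parseval HX) -[leRHS](expect_cst Pm); apply: le_expect => // t.
have -> : fourier_sum X c t = f t by rewrite fc.
by case/andP: (f01 t) => p q; rewrite exprn_ile1.
Qed.

(** Each squared coefficient of degree at most [d] is counted once per active coordinate, hence at
    most [d] times. *)
Let sum_low_inf : \sum_i low_inf c d i <= d.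
Proof.
rewrite /low_inf; under eq_bigr => i _ do rewrite big_mkcond.
rewrite exchange_big /=; apply: (@le_trans _ _ (\sum_s d * c s ^+ 2)); last first.
  by rewrite -big_distrr /= ler_piMr.
apply: ler_sum => s _; have [sd|sd] /= := boolP ((mdegree s)%:R <= d); last first.
  by rewrite big1// mulr_ge0// sqr_ge0.
rewrite -big_mkcond sumr_const -[_ *+ _]mulr_natl.
by apply: ler_wpM2r => //; exact: sqr_ge0.
Qed.

(** Coordinate [i] must be hidden, with probability 1 - r, and the other active coordinates, one
    fewer than the degree, must be revealed. *)
Let boundary_prob (r : R) i s : 0 <= r <= 1 ->
  expect (cube_mass r) (fun x : cube n => (~~ x i && boundary x i s)%:R)
  = (0 < s i)%N%:R * ((1 - r) * r ^+ (mdegree s).-1).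
Proof.
move=> r01; have [si|si] := boolP (0 < s i)%N; last first.
  rewrite mul0r -[RHS](expect_cst (cube_mass_prob n r01)).
  by apply: eq_expect => x; rewrite /boundary (negbTE si) andbF.
pose g (j : 'I_n) (b : bool) : R :=
  if j == i then (~~ b)%:R else ((0 < s j)%N ==> b)%:R.
transitivity (expect (cube_mass r) (fun x : cube n => \prod_j g j (x j))).
  apply: eq_expect => x; rewrite (bigD1 i)//= /g eqxx /boundary si /=.
  case: (x i) => /=; first by rewrite mul0r.
  rewrite mul1r; case: forallP => [H|/forallP].
    rewrite big1// => j ji; rewrite (negbTE ji).
    by have := H j; rewrite (negbTE ji) orbF => ->.
  rewrite negb_forall => /existsP[j]; rewrite negb_imply negb_or.
  move=> /and3P[sj xj ji]; rewrite (bigD1 j)//= (negbTE ji) sj (negbTE xj).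
  by rewrite mul0r.
rewrite /cube_mass (expect_prod (fun _ => bernoulli_mass r) g) (bigD1 i)//= mul1r.
congr (_ * _).
  by rewrite /expect big_bool /g /= eqxx /= mulr0 add0r mulr1.
have -> : (mdegree s).-1 = (\sum_(j | j != i) (0 < s j)%N)%N.
  rewrite /mdegree -sum1_card big_mkcond (bigD1 i)//= inE si /=.
  by apply: eq_bigr => j _; rewrite inE; case: ifP.
rewrite expr_sum; apply: eq_bigr => j ji.
rewrite /expect big_bool /g (negbTE ji) /=.
by case: (0 < s j)%N; rewrite /= ?mulr1 ?mulr0 ?addr0// addrC subrK.
Qed.

(** For low degrees, the sum of squared influences is at most tau times their sum, hence at most tau
    * d. For high degrees, summing [boundary_prob] over [i] gives each squared coefficient of degree
    k the weight k (1 - r) r^(k - 1) <= D. *)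
Theorem expect_jump4_le (r tau D : R) : 0 <= r <= 1 -> 0 <= tau -> 0 <= D ->
  (forall i, low_inf c d i <= tau) ->
  (forall k : nat, d < k%:R -> k%:R * ((1 - r) * r ^+ k.-1) <= D) ->
  expect (cube_mass r) (fun x => expect (prod_mass w) (jump4 w f x))
  <= 16 * Bd ^+ 2 * tau * d + 4 * D.
Proof.
move=> r01 tau0 D0 low high; have Pr := cube_mass_prob n r01.
pose H (x : cube n) i := \sum_(s : mindex m | ~~ ((mdegree s)%:R <= d))
   c s ^+ 2 * (~~ x i && boundary x i s)%:R.
apply: (@le_trans _ _ (expect (cube_mass r) (fun x =>
    \sum_i (16 * (Bd * low_inf c d i) ^+ 2 + 4 * H x i)))).
  apply: le_expect => // x; rewrite /jump4 expect_sum [leLHS]big_mkcond.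
  apply: ler_sum => i _; case: ifP => [xi|_].
    by apply: (le_trans (coord_bound xi)); rewrite /H xi.
  apply: addr_ge0; apply: mulr_ge0 => //; first exact: sqr_ge0.
  by apply: sumr_ge0 => s _; apply: mulr_ge0 (sqr_ge0 _) _.
rewrite expect_sum; under eq_bigr => i _ do rewrite expectD expect_cst// expectZ.
rewrite big_split -!big_distrr /=; apply: lerD.
  have -> : 16 * Bd ^+ 2 * tau * d = 16 * (Bd ^+ 2 * tau * d) by ring.
  apply: ler_wpM2l => //.
  under eq_bigr => i _ do rewrite exprMn.
  rewrite -big_distrr /= -mulrA; apply: ler_wpM2l; first exact: sqr_ge0.
  apply: le_trans (ler_wpM2l tau0 sum_low_inf); rewrite big_distrr /=.
  by apply: ler_sum => i _; rewrite expr2; apply: ler_wpM2r.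
apply: ler_wpM2l => //.
under eq_bigr => i _ do rewrite expect_sum.
rewrite exchange_big /=.
apply: (@le_trans _ _ (\sum_(s : mindex m | ~~ ((mdegree s)%:R <= d)) c s ^+ 2 * D)).
  apply: ler_sum => s; rewrite -ltNge => sd.
  under eq_bigr => i _ do rewrite expectZ boundary_prob//.
  rewrite -big_distrr; apply: ler_wpM2l; first exact: sqr_ge0.
  apply: le_trans (high _ sd); rewrite -big_distrl /=.
  apply: eq_ler; congr (_ * _).
  by rewrite /mdegree -sum1_card natr_sum [RHS]big_mkcond; apply: eq_bigr => i _;
     rewrite inE; case: ifP.
rewrite -big_distrl /= ler_piMl//; apply: le_trans sum_sqr.
rewrite [leRHS](bigID (fun s : mindex m => (mdegree s)%:R <= d)) /=.
by rewrite lerDr; apply: sumr_ge0 => s _; exact: sqr_ge0.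
Qed.

End JumpBound.

(** * The tail bound and the choice of parameters *)

Section TailBound.
Context (R : realType) (n : nat) (Omega : 'I_n -> finType).
Context (w : forall i, Omega i -> R).
Local Notation T := {dffun forall i, Omega i}.
Hypothesis Pw : forall i, is_prob (@w i).
Variable f : T -> R.
Hypothesis f01 : forall t, 0 <= f t <= 1.
Let Pm : is_prob (prod_mass w) := prod_mass_prob Pw.

Lemma prob_joint_le (rho k : R) (A : pred (T * cube n)) (G : cube n -> T -> R) :
  0 <= rho <= 1 ->
  (forall p, A p -> 1 <= k * G p.2 p.1) -> (forall x t, 0 <= k * G x t) ->
  prob (joint_mass w rho) A
  <= k * expect (cube_mass rho) (fun x => expect (prod_mass w) (G x)).
Proof.
move=> rho01 AG G0; have Pr := cube_mass_prob n rho01.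
rewrite expect_exchange -expectZ.
under eq_expect => t do rewrite -expectZ.
rewrite /prob /expect; under [leRHS]eq_bigr do rewrite big_distrr.
rewrite pair_big big_mkcond /=; apply: ler_sum => -[t x] _ /=.
rewrite mulrA /joint_mass /=.
have J0 : 0 <= prod_mass w t * cube_mass rho x.
  by apply: mulr_ge0; [exact: Pm.1|exact: Pr.1].
case: ifP => [/AG /= kG|_]; last exact: mulr_ge0.
by rewrite ler_peMr.
Qed.

(** On the event, the conditional mean v of h = 1 - (1 - eta) f is at most 1 - (1 - eta)^2 <= 2 eta,
    so v^a <= lam and the potential is at least 1 / (2 lam); Markov's inequality then gives the
    factor 2 lam. At time 0 the exponent is 1/theta - 1 and E h >= 1 - mu. The jumps of h are those
    of f scaled by 1 - eta in absolute value. *)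
Lemma tail_bound (rho theta lam eta delta vt Gam : R) :
  0 < rho -> rho < 1 -> 0 < theta -> theta < 1 -> 0 < lam ->
  0 < eta -> eta <= 1 -> 0 < vt -> 4 * vt <= eta -> delta <= eta ->
  expect (prod_mass w) f < 1 ->
  (forall s, 0 <= s -> s <= rho ->
    expect (cube_mass s) (fun x => expect (prod_mass w) (jump4 w f x)) <= Gam) ->
  expR (exponent (1 - theta) rho * ln (2 * eta)) <= lam ->
  prob (joint_mass w rho) (fun p => 1 - delta < Vop w f p)
  <= 2 * lam * (expR ((theta^-1 - 1) * - ln (1 - expect (prod_mass w) f))
     + 2000 * theta^-1 ^+ 3 / (lam * eta ^+ 3) * (vt + Gam / vt ^+ 2) / (1 - rho)).
Proof.
move=> rho0 rho1 th0 th1 lam0 eta0 eta1 vt0 vteta de mu1 jump lamE.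
pose h (t : T) := 1 - (1 - eta) * f t.
have e1 : 0 <= 1 - eta by rewrite subr_ge0.
have h_itv t : eta <= h t <= 1.
  by rewrite /h; case/andP: (f01 t) => p q; apply/andP; split; nra.
have vE x t : restr_mean w h x t = 1 - (1 - eta) * restr_mean w f x t.
  rewrite /restr_mean /Vop /h.
  by rewrite expectB expect_cst// expectZ.
have jump_le s : 0 <= s -> s <= rho ->
    expect (cube_mass s) (fun x => expect (prod_mass w) (jump4 w h x)) <= Gam.
  move=> s0 sr; have Ps : is_prob (@cube_mass R n s).
    by apply: cube_mass_prob; rewrite s0 (le_trans sr)// ltW.
  apply: le_trans (jump s s0 sr); apply: le_expect => // x; apply: le_expect => // t.
  apply: ler_sum => i xi; apply: le_expect => // b.
  have -> : incr w h x t b = - (1 - eta) * incr w f x t b.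
    by rewrite /incr !vE; ring.
  rewrite exprMn; apply: ler_piMl; first by rewrite exprn_even_ge0.
  rewrite [_ ^+ 4](_ : _ = (1 - eta) ^+ 4); last by ring.
  by rewrite exprn_ile1// gerBl ltW.
have c0 : 0 < 1 - theta by rewrite subr_gt0.
have c1 : 1 - theta < 1 by rewrite gtrBl.
have main := reveal_potential_le Pw eta0 h_itv lam0 c0 c1 rho0 rho1 vt0 vteta jump_le.
have cE : 1 - (1 - theta) = theta by ring.
rewrite cE in main.
have a0 : 0 <= theta^-1 - 1 by rewrite subr_ge0 invf_ge1// ltW.
set mu := expect (prod_mass w) f.
have mu0 : 0 <= mu by apply: expect_ge0 => // t; case/andP: (f01 t).
have Eh : expect (prod_mass w) h = 1 - (1 - eta) * mu.
  by rewrite /h expectB expect_cst// expectZ.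
have Eh_ge : 1 - mu <= 1 - (1 - eta) * mu.
  by rewrite lerD2l lerN2 ler_piMl// gerBl ltW.
have pot0 : potential lam (exponent (1 - theta) 0) (expect (prod_mass w) h)
    <= expR ((theta^-1 - 1) * - ln (1 - mu)).
  have -> : exponent (1 - theta) 0 = theta^-1 - 1.
    by rewrite /exponent subr0 mulr1 cE.
  have mu1' : 0 < 1 - mu by rewrite subr_gt0.
  rewrite mulrN expRN /potential lef_pV2 ?posrE ?expR_gt0//; last first.
    by rewrite addr_gt0// expR_gt0.
  apply: (@le_trans _ _ (expR ((theta^-1 - 1) * ln (expect (prod_mass w) h)))).
    rewrite ler_expR; apply: ler_wpM2l => //; rewrite ler_ln ?posrE// Eh//.
    exact: lt_le_trans Eh_ge.
  by rewrite lerDl ltW.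
have l20 : 0 < 2 * lam by rewrite mulr_gt0.
have aR := exponent_ge0 c0 c1 (ltW rho0) rho1.
apply: le_trans (_ : _ <= 2 * lam * expect (cube_mass rho) (fun x =>
    expect (prod_mass w) (fun t => potential lam (exponent (1 - theta) rho)
      (restr_mean w h x t)))) _; last first.
  apply: ler_wpM2l; first exact: ltW.
  by apply: (le_trans main); rewrite lerD2r.
apply: (@prob_joint_le rho (2 * lam) _ (fun x t => potential lam
   (exponent (1 - theta) rho) (restr_mean w h x t))).
- by rewrite !ltW.
- move=> [t x] /= Vt.
  have v2 : restr_mean w h x t <= 2 * eta.
    rewrite vE; have : 1 - delta < restr_mean w f x t by [].
    move: (restr_mean w f x t) => V Vd.
    have Vd' : 1 - eta <= V by lra.
    by have := ler_wpM2l e1 Vd'; nra.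
  have /andP[ve _] := restr_mean_itv Pw h_itv x t.
  have v0 : 0 < restr_mean w h x t := lt_le_trans eta0 ve.
  have le1 : expR (exponent (1 - theta) rho * ln (restr_mean w h x t)) <= lam.
    apply: le_trans lamE; rewrite ler_expR; apply: ler_wpM2l => //.
    by rewrite ler_ln ?posrE// mulr_gt0.
  rewrite /potential ler_pdivlMr ?mul1r; last by rewrite addr_gt0// expR_gt0.
  by lra.
- move=> x t; have [p _ _ _] := potential_bounds (exponent (1 - theta) rho)
    (restr_mean w h x t) lam0.
  exact: mulr_ge0 (ltW l20) p.
Qed.

End TailBound.

(** * Numerical budgets for the exponent and the errors *)

Section ParameterChoice.
Context (R : realType).

Lemma ln2_itv : 0 <= (ln 2 : R) <= 1.
Proof.
apply/andP; split; first by rewrite ln_ge0// ler1n.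
by have := @le_ln1Dx R 1; apply; lra.
Qed.

(** Here s = 1 / (a + 1), and the inequality of exponents is multiplied by s. With q = theta * L,
    the slack 10 q pays q from s * L, 2 q from M / theta and at most 5 q from the cross term 10
    theta q; the remaining 2 q covers the constants, as 3 <= q. This is the origin of C = 10. *)
Lemma exponent_choice (rho theta L M : R) : 0 < rho -> rho < 1 ->
  0 < theta -> theta <= 1 / 2 -> 3 <= theta * L -> M / theta <= 2 * (theta * L) ->
  expR (exponent (1 - theta) rho
    * ln (2 * expR (- ((1 - rho)^-1 * L * (rho + 10 * theta)))))
  <= expR (- L - M / theta) / 4.
Proof.
move=> rho0 rho1 th0 th1 q3 Mq.
have /andP[l0 l1] := ln2_itv.
have -> : 4 = expR (ln 2 + ln 2) :> R by rewrite expRD lnK ?posrE//; ring.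
rewrite -expRB ler_expR lnM ?posrE ?expR_gt0// expRK.
rewrite /exponent; set s := 1 - (1 - theta) * (1 - rho).
have s0 : 0 < s by rewrite /s; nra.
have s1 : s <= 1 by rewrite /s; nra.
set y := ln 2 + _; set z := - L - _ - _.
have -> : (s^-1 - 1) * y = (1 - s) * y / s by field; rewrite gt_eqF.
rewrite ler_pdivrMr//.
have yE : (1 - s) * y = (1 - s) * ln 2 - (1 - theta) * (L * (rho + 10 * theta)).
  by rewrite /y /s; field; rewrite subr_eq0 gt_eqF.
rewrite yE /z; move: Mq; move: (M / theta) (ln 2) l0 l1 => m l l0 l1 Mq.
have h1 : (1 - s) * l <= 1 by nra.
have h2 : s * (m + (l + l)) <= 2 * (theta * L) + 2 by nra.
have h3 : theta * (theta * L) <= 1 / 2 * (theta * L) by rewrite ler_wpM2r//; lra.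
have sE : s * L = rho * L + theta * L - rho * (theta * L) by rewrite /s; ring.
have tE : (1 - theta) * (L * (rho + 10 * theta)) =
   rho * L + 10 * (theta * L) - rho * (theta * L) - 10 * (theta * (theta * L)).
  by ring.
by rewrite tE; move: h1 h2 h3 sE; lra.
Qed.

(** Since rho (1 - rho) <= 1/4, K' dominates the logarithm of Bonami's constant 4 / alpha. *)
Lemma Kprime_ge (alpha rho : R) : 0 < alpha -> alpha <= 1 / 2 ->
  0 < rho -> rho < 1 ->
  1 / 2 <= Kprime alpha rho /\ ln (4 / alpha) <= Kprime alpha rho.
Proof.
move=> a0 a1 rho0 rho1.
have rr : rho * (1 - rho) <= 1 / 4 by have := sqr_ge0 (rho - 1 / 2); lra.
have rr0 : 0 < rho * (1 - rho) by rewrite mulr_gt0// subr_gt0.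
have p0 : 0 < alpha * rho * (1 - rho) by rewrite -mulrA mulr_gt0.
split.
  rewrite /Kprime [1 / (_ * _)]div1r lnV ?posrE//.
  have E : 1 + (alpha * rho * (1 - rho) - 1) = alpha * rho * (1 - rho) by ring.
  have := @le_ln1Dx R (alpha * rho * (1 - rho) - 1); rewrite E.
  have -> : -1 < alpha * rho * (1 - rho) - 1 by lra.
  by move=> /(_ isT); have : alpha * (rho * (1 - rho)) <= 1 / 2 * (1 / 4); nra.
rewrite /Kprime ler_ln ?posrE ?divr_gt0//.
by rewrite ler_pdivrMr// mulrC mulrA ler_pdivlMr//; nra.
Qed.

Lemma expR_ge (x : R) : x <= expR x.
Proof. by apply: le_trans (expR_ge1Dx x); rewrite lerDr. Qed.

(** From s <= 1 - 1/r <= e^(-1/r), the power with exponent j = k - 1 is at most e^(-j/r). Half of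
    this decay absorbs the polynomial factor through j + 1 <= 2 r e^(j / (2 r)). *)
Lemma geometric_weight (rho s r y : R) (k : nat) : 0 <= s -> s <= rho -> rho < 1 ->
  r = (1 - rho)^-1 -> y <= (k%:R - 1) / (2 * r) ->
  k%:R * ((1 - s) * s ^+ k.-1) <= 2 * r * expR (- y).
Proof.
move=> s0 sr rho1 rE ky.
have r1 : 1 <= r by rewrite rE invf_ge1 ?subr_gt0//; lra.
have r0 : 0 < r by lra.
case: k ky => [|k] ky; first by rewrite mul0r mulr_ge0 ?expR_ge0//; lra.
rewrite /=; have kE : k.+1%:R - 1 = k%:R :> R by rewrite -natr1 addrK.
rewrite kE in ky; set z : R := k%:R / (2 * r) in ky.
have z0 : 0 <= z by rewrite divr_ge0//; lra.
have sk : s ^+ k <= expR (- (2 * z)).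
  have -> : - (2 * z) = k%:R * (- r^-1) by rewrite /z; field; rewrite gt_eqF.
  rewrite expRM_natl; apply: lerXn2r; rewrite ?nnegrE ?expR_ge0//.
  apply: (le_trans sr); apply: le_trans (expR_ge1Dx _); rewrite rE invrK; lra.
have kz : k.+1%:R <= 2 * r * expR z.
  apply: (@le_trans _ _ (2 * r * (1 + z))).
    have -> : 2 * r * (1 + z) = 2 * r + k%:R by rewrite /z; field; rewrite gt_eqF.
    by rewrite -natr1; lra.
  by apply: ler_wpM2l (expR_ge1Dx z); lra.
have s1 : (1 - s) * s ^+ k <= s ^+ k by rewrite ler_piMl ?exprn_ge0//; lra.
have : k.+1%:R * ((1 - s) * s ^+ k) <= 2 * r * expR z * expR (- (2 * z)).
  apply: ler_pM kz (le_trans s1 sk) => //.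
  by apply: mulr_ge0; [lra|exact: exprn_ge0].
move=> /le_trans; apply; rewrite -mulrA -expRD; apply: ler_wpM2l; first lra.
by rewrite ler_expR; lra.
Qed.

(** With T = ln(1/tau), the squared Bonami weight costs e^(T/2) and the factor d at most 2 e^(T/4),
    so the low-degree term keeps e^(-T/4), and T >= 200 r L. The constant factors cost a few
    multiples of r L in the exponent. *)
Lemma jump_budget (T K d r L : R) : 1 <= r -> 2000 * r <= L ->
  1 / 2 <= K -> 400 * K * r ^+ 4 * L <= T -> d = T / (4 * K) ->
  16 * expR (T / 4) ^+ 2 * expR (- T) * d + 4 * (2 * r * expR (- (40 * (r * L))))
  <= expR (- (36 * (r * L))).
Proof.
move=> r1 rL K2 TK dE.
have K0 : 0 < K by lra.
have L0 : 0 < L by lra.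
have rL1 : L <= r * L by rewrite ler_peMl// ltW.
have r4 : r <= r ^+ 4 by rewrite ler_eXnr.
have T1 : 200 * (r * L) <= T.
  apply: le_trans TK.
  have := ler_wpM2r (ltW L0) r4; set a := r * L; set b := r ^+ 4 * L => ab.
  have b0 : 0 <= b by rewrite /b mulr_ge0 ?exprn_ge0//; lra.
  have -> : 400 * K * r ^+ 4 * L = 400 * (K * b) by rewrite /b; ring.
  by have := ler_wpM2r b0 K2; lra.
have dT : d <= 2 * expR (T / 4).
  rewrite dE ler_pdivrMr ?mulr_gt0//.
  have := expR_ge (T / 4); have := expR_gt0 (T / 4).
  by move: (expR (T / 4)) => e e0 eT; nra.
clear TK dE.
have A : 16 * expR (T / 4) ^+ 2 * expR (- T) * d <= 32 * expR (- (T / 4)).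
  have -> : 32 * expR (- (T / 4)) =
     16 * expR (T / 4) ^+ 2 * expR (- T) * (2 * expR (T / 4)).
    rewrite (_ : - (T / 4) = T / 4 + T / 4 - T + T / 4); last by field.
    by rewrite !expRD; ring.
  apply: ler_wpM2l dT; apply: mulr_ge0 (expR_ge0 _).
  by apply: mulr_ge0 (sqr_ge0 _).
have L32 : 32 <= expR (r * L) by apply: le_trans (expR_ge _); lra.
have L8 : 8 * r <= expR (r * L) by apply: le_trans (expR_ge _); lra.
have e2 : 2 <= expR (r * L) by lra.
have A' : 32 * expR (- (T / 4)) <= expR (- (37 * (r * L))).
  apply: (@le_trans _ _ (expR (r * L) * expR (- (T / 4)))).
    by rewrite ler_wpM2r ?expR_ge0.
  by rewrite -expRD ler_expR; lra.
have B : 4 * (2 * r * expR (- (40 * (r * L)))) <= expR (- (37 * (r * L))).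
  apply: (@le_trans _ _ (expR (r * L) * expR (- (40 * (r * L))))).
    by rewrite !mulrA; apply: ler_wpM2r; rewrite ?expR_ge0//; lra.
  by rewrite -expRD ler_expR; lra.
have -> : expR (- (36 * (r * L))) = expR (r * L) * expR (- (37 * (r * L))).
  by rewrite -expRD; congr expR; ring.
have := ler_wpM2r (expR_ge0 (- (37 * (r * L)))) e2.
by lra.
Qed.

(** The exponent 36 is three times 12, so with vt = e^(-12 x) both summands equal vt. The prefactor
    is at most e^(10 x): 3 each from theta, lam and eta, and 1 from 2000 r. The surplus e^(-2 x)
    absorbs the factor 2. *)
Lemma error_budget (theta lam eta r x : R) : 0 < theta -> 0 < lam -> 0 < eta ->
  0 <= r -> theta^-1 <= expR x -> lam^-1 <= expR x ^+ 3 -> eta^-1 <= expR x ->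
  2000 * r <= expR x -> 2 <= expR x ->
  2000 * theta^-1 ^+ 3 / (lam * eta ^+ 3)
    * (expR (- (12 * x)) + expR (- (36 * x)) / expR (- (12 * x)) ^+ 2) * r <= 1.
Proof.
move=> th0 l0 e0 r0 thx lx ex rx x2.
have eN (k : nat) : expR (- (k%:R * x)) = (expR x ^+ k)^-1.
  by rewrite expRN expRM_natl.
rewrite !eN; move: (expR x) (expR_gt0 x) thx lx ex rx x2 => e ep thx lx ex rx x2.
have -> : (e ^+ 12)^-1 + (e ^+ 36)^-1 / (e ^+ 12)^-1 ^+ 2 = 2 * (e ^+ 12)^-1.
  by field; rewrite gt_eqF.
have -> : 2000 * theta^-1 ^+ 3 / (lam * eta ^+ 3) * (2 * (e ^+ 12)^-1) * r
  = ((2000 * r) * (theta^-1 ^+ 3 * (lam^-1 * eta^-1 ^+ 3))) * (2 * (e ^+ 12)^-1).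
  by field; rewrite !gt_eqF.
have th3 : theta^-1 ^+ 3 <= e ^+ 3.
  by apply: lerXn2r thx; rewrite nnegrE ltW// invr_gt0.
have e3 : eta^-1 ^+ 3 <= e ^+ 3.
  by apply: lerXn2r ex; rewrite nnegrE ltW// invr_gt0.
have i0 (y : R) : 0 < y -> 0 <= y^-1 by move=> y0; rewrite invr_ge0 ltW.
have A1 : lam^-1 * eta^-1 ^+ 3 <= e ^+ 3 * e ^+ 3.
  by apply: ler_pM lx e3; [exact: i0|apply: exprn_ge0; exact: i0].
have A2 : theta^-1 ^+ 3 * (lam^-1 * eta^-1 ^+ 3) <= e ^+ 3 * (e ^+ 3 * e ^+ 3).
  apply: ler_pM th3 A1; first by apply: exprn_ge0; exact: i0.
  by apply: mulr_ge0; [exact: i0|apply: exprn_ge0; exact: i0].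
have A3 : (2000 * r) * (theta^-1 ^+ 3 * (lam^-1 * eta^-1 ^+ 3))
    <= e * (e ^+ 3 * (e ^+ 3 * e ^+ 3)).
  apply: ler_pM rx A2; first exact: mulr_ge0 (ler0n _ _) r0.
  apply: mulr_ge0; first by apply: exprn_ge0; exact: i0.
  by apply: mulr_ge0; [exact: i0|apply: exprn_ge0; exact: i0].
have p0 : 0 <= 2 * (e ^+ 12)^-1.
  by apply: mulr_ge0 (ler0n _ _) (i0 _ _); exact: exprn_gt0.
apply: (le_trans (ler_wpM2r p0 A3)).
have -> : e * (e ^+ 3 * (e ^+ 3 * e ^+ 3)) * (2 * (e ^+ 12)^-1) = 2 / e * e^-1.
  by field; rewrite gt_eqF.
have ei1 : 2 / e <= 1 by rewrite ler_pdivrMr// mul1r.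
have ei2 : e^-1 <= 1 by rewrite invf_le1//; apply: le_trans x2; rewrite ler1n.
rewrite -[leRHS](mulr1 1); apply: ler_pM ei1 ei2; last exact: i0.
exact: mulr_ge0 (ler0n _ _) (i0 _ ep).
Qed.

End ParameterChoice.

Lemma low_inf_le (R : realType) (n : nat) (m : 'I_n -> nat) (c : mindex m -> R)
    (d1 d2 : R) i : d1 <= d2 -> low_inf c d1 i <= low_inf c d2 i.
Proof.
move=> d12; rewrite /low_inf big_mkcond [leRHS]big_mkcond; apply: ler_sum => s _.
case: ifP => [/andP[sd ->]|_]; first by rewrite (le_trans sd d12).
by case: ifP => _; rewrite ?sqr_ge0.
Qed.

Lemma jump4_small (R : realType) (n : nat) (Omega : 'I_n -> finType)
    (w : forall i, Omega i -> R) (f : {dffun forall i, Omega i} -> R)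
    (alpha tau rho r L : R) (m : 'I_n -> nat)
    (X : forall i, 'I_(m i).+1 -> Omega i -> R) (c : mindex m -> R)
    (K := Kprime alpha rho) :
  (forall i, is_prob (w i)) -> (forall t, 0 <= f t <= 1) ->
  0 < alpha -> alpha <= 1 / 2 -> (forall i (a : Omega i), alpha <= w i a) ->
  (forall i, orthonormal_basis1 (w i) (X i)) -> is_expansion X f c ->
  0 < tau -> (forall i, low_inf c (- ln tau / K) i <= tau) ->
  0 < rho -> rho < 1 -> r = (1 - rho)^-1 -> 2000 * r <= L ->
  400 * K * r ^+ 4 * L <= - ln tau ->
  forall s, 0 <= s -> s <= rho ->
  expect (cube_mass s) (fun x => expect (prod_mass w) (jump4 w f x))
  <= expR (- (36 * (r * L))).
Proof.
move=> Pw f01 a0 a1 aw HX fc t0 low rho0 rho1 rE rL TK s s0 sr.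
have [K2 lK] := Kprime_ge a0 a1 rho0 rho1; rewrite -/K in K2 lK.
have r1 : 1 <= r by rewrite rE invf_ge1 ?subr_gt0//; lra.
have L1 : 1 <= L by lra.
have b0 : 0 <= r ^+ 4 * L by apply: mulr_ge0; [apply: exprn_ge0|]; lra.
have T2 : 400 * (K * (r ^+ 4 * L)) <= - ln tau by move: TK; rewrite -!mulrA.
have K0 : 0 < K by lra.
have Tp : 0 <= - ln tau.
  apply: le_trans T2; apply: mulr_ge0 (ler0n _ _) _.
  by apply: mulr_ge0 b0; exact: ltW.
set T := - ln tau in low TK T2 Tp *.
have tauE : tau = expR (- T) by rewrite /T opprK lnK.
(* A quarter of the permitted degree: Bonami's weight is then at most e^(d K) = e^(T/4), while d >=
   100 r^4 L still exceeds the 80 r^2 L + 1 that [geometric_weight] requires for a tail of order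
   e^(-40 r L). *)
pose d := T / (4 * K).
have d0 : 0 <= d by rewrite /d divr_ge0// mulr_ge0// ltW.
have dbig : 100 * (r ^+ 4 * L) <= d.
  by rewrite /d ler_pdivlMr ?mulr_gt0//; move: T2; move: (r ^+ 4 * L) => z; lra.
have Bd_ge (k : nat) : k%:R <= d -> (4 / alpha) ^+ k <= expR (T / 4).
  move=> kd; rewrite -[4 / alpha]lnK ?posrE ?divr_gt0//.
  rewrite -expRM_natl ler_expR; apply: (@le_trans _ _ (d * K)).
    apply: le_trans (ler_wpM2l (ler0n _ _) lK) _.
    by apply: ler_wpM2r kd; exact: ltW.
  by apply: eq_ler; rewrite /d; field; rewrite gt_eqF.
have D0 : 0 <= 2 * r * expR (- (40 * (r * L))).
  by apply: mulr_ge0 (expR_ge0 _); lra.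
have s01 : 0 <= s <= 1 by rewrite s0 (le_trans sr)// ltW.
apply: le_trans (jump_budget r1 rL K2 TK (erefl d)).
rewrite -tauE.
apply: (expect_jump4_le Pw HX f01 fc a0 a1 aw d0 Bd_ge s01 (ltW t0) D0).
  move=> i; apply: le_trans (low i); apply: low_inf_le.
  rewrite /d ler_pdivrMr ?mulr_gt0//.
  have -> : T / K * (4 * K) = 4 * T by field; rewrite gt_eqF.
  by lra.
move=> k dk; apply: (geometric_weight s0 sr rho1 rE).
rewrite ler_pdivlMr; last lra.
have r4 : r * r <= r ^+ 4.
  have -> : r ^+ 4 = (r * r) * (r * r) by ring.
  have rr1 : 1 <= r * r by rewrite -[leLHS](mulr1 1); apply: ler_pM.
  by rewrite ler_peMl// (le_trans ler01).
have := ler_wpM2r (le_trans ler01 L1) r4.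
have : 1 <= r ^+ 4 * L.
  by rewrite -[leLHS](mulr1 1); apply: ler_pM => //; rewrite exprn_ege1.
move: dbig dk; move: (r ^+ 4 * L) => z; move: (k%:R) => k' zd dk z1 rz.
have -> : 40 * (r * L) * (2 * r) = 80 * (r * r * L) by ring.
lra.
Qed.

(* Here [theta] is [sqrt (c_mu mu eps / ln (1 / eps))]. *)
Lemma threshold_exists (R : realType) (rho mu : R) :
  0 < rho -> rho < 1 -> 0 < mu -> mu < 1 ->
  exists eps0 : R, 0 < eps0 /\ forall eps, 0 < eps -> eps <= eps0 ->
  exists theta : R,
    [/\ 0 < theta, 10 * theta <= 1 - rho, 3 <= theta * - ln eps,
        - ln (1 - mu) / theta <= 2 * (theta * - ln eps)
      & theta^-1 <= - ln eps]
    /\ kappa rho mu eps = theta / (1 - rho) /\ 2000 / (1 - rho) <= - ln eps.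
Proof.
move=> rho0 rho1 mup mu1.
have mu1' : 0 < 1 - mu by rewrite subr_gt0.
have rho1' : 0 < 1 - rho by rewrite subr_gt0.
have {rho1} r1 : 1 <= (1 - rho)^-1 by rewrite invf_ge1//; lra.
have {rho0} rhor : (1 - rho) * (1 - rho)^-1 = 1 by rewrite divff ?gt_eqF.
set r := (1 - rho)^-1 in r1 rhor *.
set M := - ln (1 - mu).
have M0 : 0 <= M by rewrite /M oppr_ge0 ln_le0// gerBl ltW.
(* The terms ensure, in order: mu * L >= 9, hence theta * L >= 3; 10 theta <= 1 - rho, since cc <= M
   + 2; and the bound 2000 r <= L. *)
pose L0 := 10 / mu + 100 * (M + 2) * r ^+ 2 + 2000 * r.
exists (expR (- L0)); split=> [|eps e0 e1]; first exact: expR_gt0.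
set L := - ln eps.
have epsE : eps = expR (- L) by rewrite /L opprK lnK.
have LL0 : L0 <= L by move: e1; rewrite epsE ler_expR lerN2.
have h10 : 0 <= 10 / mu by rewrite divr_ge0// ltW.
have hM : 0 <= 100 * (M + 2) * r ^+ 2.
  by apply: mulr_ge0 (sqr_ge0 _); apply: mulr_ge0 => //; lra.
have [Lmu LM Lr] : [/\ 10 / mu <= L, 100 * (M + 2) * r ^+ 2 <= L & 2000 * r <= L].
  by move: LL0; rewrite /L0; split; lra.
have L1 : 0 < L by clear - Lr r1; lra.
rewrite [2000 / _]/(2000 * r).
have eps1 : eps <= 1.
  by rewrite epsE -[leRHS]expR0 ler_expR oppr_le0 ltW.
suff [theta [th H]] : exists theta : R,
    [/\ 0 < theta, 10 * theta <= 1 - rho, 3 <= theta * L,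
        M / theta <= 2 * (theta * L) & theta^-1 <= L]
    /\ kappa rho mu eps = theta * r by exists theta.
clear Lr LL0 L0 e1 h10 hM.
move: Lmu; rewrite ler_pdivrMr// [L * _]mulrC => Lmu.
pose cc := c_mu mu eps.
have ccE : cc = mu * (1 + M) + eps.
  by rewrite /cc /c_mu ln_div ?posrE ?expR_gt0// expRK.
have cc_ge : mu <= cc by rewrite ccE; clear - mup M0 e0; nra.
have cc_le : cc <= M + 2 by rewrite ccE; clear - mu1 M0 eps1; nra.
(* Since theta^2 L = cc, this is the balance M / theta <= 2 theta L. For mu >= 1/2 the summand mu *
   M of cc suffices; otherwise M <= mu / (1 - mu). *)
have M_le : M <= 2 * cc.
  rewrite ccE; have [mh|mh] := leP (1 / 2) mu; first by clear - mh M0 e0; nra.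
  have : M <= mu / (1 - mu).
    rewrite /M -lnV ?posrE//.
    have := @le_ln1Dx R (mu / (1 - mu)).
    have -> : 1 + mu / (1 - mu) = (1 - mu)^-1 by field; rewrite gt_eqF.
    apply; apply: lt_le_trans (divr_ge0 (ltW mup) (ltW mu1')).
    by rewrite oppr_lt0.
  rewrite ler_pdivlMr// => M1.
  by clear - mh M0 M1 e0 mup; nra.
have cc0 : 0 < cc := lt_le_trans mup cc_ge.
pose theta := Num.sqrt cc / Num.sqrt L.
have th0 : 0 < theta by rewrite divr_gt0 ?sqrtr_gt0.
have th2 : theta ^+ 2 * L = cc.
  rewrite /theta expr_div_n !sqr_sqrtr ?ltW//.
  by field; rewrite gt_eqF.
have thr : theta * (10 * r) <= 1.
  have p : 0 <= theta * (10 * r).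
    by apply: mulr_ge0; [exact: ltW|clear - r1; lra].
  rewrite -(@ler_pXn2r _ 2) ?nnegrE// expr1n -(ler_pM2r L1) mul1r.
  apply: le_trans LM.
  have -> : (theta * (10 * r)) ^+ 2 * L = 100 * cc * r ^+ 2.
    by rewrite -th2; ring.
  by apply: ler_wpM2r; [exact: sqr_ge0|clear - cc_le; lra].
have th_rho : 10 * theta <= 1 - rho.
  have := ler_wpM2l (ltW rho1') thr.
  have -> : (1 - rho) * (theta * (10 * r)) = 10 * theta * ((1 - rho) * r) by ring.
  by rewrite rhor !mulr1.
have q3 : 3 <= theta * L.
  have p : 0 <= theta * L by rewrite mulr_ge0 ?ltW.
  rewrite -(@ler_pXn2r _ 2) ?nnegrE//.
  have -> : (theta * L) ^+ 2 = cc * L by rewrite -th2; ring.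
  have : mu * L <= cc * L by rewrite ler_wpM2r// ltW.
  by clear - Lmu; lra.
exists theta; split; first split=> //.
- rewrite ler_pdivrMr//.
  have -> : 2 * (theta * L) * theta = 2 * (theta ^+ 2 * L) by ring.
  by rewrite th2.
- by rewrite -[leLHS]mulr1 ler_pdivrMl//; clear - q3; lra.
- have lnL : ln (1 / eps) = L by rewrite div1r lnV.
  by rewrite /kappa -/cc lnL div1r /theta /r; ring.
Qed.

Lemma prob_restriction_le (R : realType) (n : nat) (Omega : 'I_n -> finType)
    (w : forall i, Omega i -> R) (f : {dffun forall i, Omega i} -> R)
    (alpha tau rho theta eps delta : R) (m : 'I_n -> nat)
    (X : forall i, 'I_(m i).+1 -> Omega i -> R) (c : mindex m -> R)
    (K := Kprime alpha rho) (r := (1 - rho)^-1)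
    (M := - ln (1 - expect (prod_mass w) f)) :
  (forall i, is_prob (w i)) -> (forall t, 0 <= f t <= 1) ->
  expect (prod_mass w) f < 1 ->
  0 < alpha -> alpha <= 1 / 2 -> (forall i (a : Omega i), alpha <= w i a) ->
  (forall i, orthonormal_basis1 (w i) (X i)) -> is_expansion X f c ->
  0 < tau -> (forall i, low_inf c (- ln tau / K) i <= tau) ->
  0 < rho -> rho < 1 -> 0 < eps ->
  0 < theta -> 10 * theta <= 1 - rho -> 3 <= theta * - ln eps ->
  M / theta <= 2 * (theta * - ln eps) -> theta^-1 <= - ln eps ->
  2000 * r <= - ln eps ->
  delta <= expR (- (r * - ln eps * (rho + 10 * theta))) ->
  400 * K * r ^+ 4 * - ln eps <= - ln tau ->
  prob (joint_mass w rho) (fun p => 1 - delta < Vop w f p) <= eps.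
Proof.
move=> Pw f01 mu1 a0 a1 aw HX fc t0 low rho0 rho1 e0 th0 th_rho q3 Mq thi Lr de TK.
have jump := jump4_small Pw f01 a0 a1 aw HX fc t0 low rho0 rho1 erefl Lr TK.
clear TK low fc HX aw a0 a1 K c X m t0 alpha tau.
have epsE : eps = expR (- - ln eps) by rewrite opprK lnK.
move: (- ln eps) epsE q3 Mq thi Lr de jump => L epsE q3 Mq thi Lr de jump.
have r1 : 1 <= r by rewrite /r invf_ge1 ?subr_gt0//; clear - rho0; lra.
have L10 : 2000 <= L by clear - Lr r1; lra.
have M0 : 0 <= M.
  rewrite /M oppr_ge0 ln_le0// gerBl; apply: expect_ge0; first exact: prod_mass_prob.
  by move=> t; case/andP: (f01 t).
have L1 : 0 < L by clear - L10; lra.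
set eta := expR _ in de; pose x := r * L.
have Lx : L <= x by rewrite /x ler_peMl// ltW.
have x0 : 0 <= x by apply: le_trans Lx; exact: ltW.
have eta_ge : expR (- x) <= eta.
  rewrite ler_expR lerN2 -/x ler_piMr//.
  by clear - th_rho; lra.
have eta0 : 0 < eta := expR_gt0 _.
have eta1 : eta <= 1.
  rewrite -[leRHS]expR0 ler_expR oppr_le0; apply: mulr_ge0 => //.
  by clear - th0 rho0; lra.
(* Equal to eps * e^(-M / theta) / 4. The 4 offsets the factor 2 lam of [tail_bound] and its two
   summands, the initial potential and the error, each at most e^(M / theta). *)
pose lam := expR (- L - M / theta) / 4.
have lam0 : 0 < lam by rewrite divr_gt0 ?expR_gt0.
have e32 : 2 <= expR x by apply: le_trans (expR_ge x); clear - L10 Lx; lra.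
have vt0 : 0 < expR (- (12 * x)) := expR_gt0 _.
have vteta : 4 * expR (- (12 * x)) <= eta.
  apply: le_trans eta_ge; have -> : expR (- x) = expR (11 * x) * expR (- (12 * x)).
    by rewrite -expRD; congr expR; ring.
  apply: ler_wpM2r; first exact: ltW.
  by apply: le_trans (expR_ge _); clear - L10 Lx; lra.
have th12 : theta <= 1 / 2 by clear - th_rho rho0; lra.
have lamE : expR (exponent (1 - theta) rho * ln (2 * eta)) <= lam.
  exact: exponent_choice.
have th1 : theta < 1 by clear - th12; lra.
apply: (le_trans (tail_bound Pw f01 rho0 rho1 th0 th1 lam0 eta0 eta1 vt0 vteta
   de mu1 jump lamE)).
rewrite -/M.
have thx : theta^-1 <= expR x := le_trans thi (le_trans Lx (expR_ge x)).
have Mth : M / theta <= L.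
  by apply: (le_trans Mq); have := ler_wpM2r (ltW L1) th12; clear; lra.
have lami : lam^-1 <= expR x ^+ 3.
  rewrite /lam invf_div -expRN.
  have -> : expR x ^+ 3 = expR x * expR (x + x) by rewrite expRD; ring.
  apply: ler_pM; [exact: ler0n|exact: expR_ge0| |].
    by apply: le_trans (expR_ge x); clear - L10 Lx; lra.
  by rewrite ler_expR; clear - Mth Lx; lra.
have etai : eta^-1 <= expR x.
  by rewrite -[x]opprK expRN lef_pV2 ?posrE ?expR_gt0.
have r2000 : 2000 * r <= expR x := le_trans Lr (le_trans Lx (expR_ge x)).
have err := error_budget th0 lam0 eta0 (le_trans ler01 r1) thx lami etai r2000 e32.
have main : expR ((theta^-1 - 1) * M) <= expR (M / theta).
  by rewrite ler_expR mulrBl mul1r mulrC gerBl.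
have one : 1 <= expR (M / theta) by rewrite -[leLHS]expR0 ler_expR divr_ge0// ltW.
have lamM : 4 * (lam * expR (M / theta)) = eps.
  have -> : eps = expR (- L - M / theta) * expR (M / theta) by rewrite -expRD subrK.
  by rewrite /lam; field.
apply: (@le_trans _ _ (2 * lam * (expR (M / theta) + expR (M / theta)))).
  apply: ler_wpM2l; first by apply: mulr_ge0 => //; exact: ltW.
  by apply: lerD main (le_trans err one).
by rewrite -lamM; apply: eq_ler; ring.
Qed.

Theorem theorem4p9 (R : realType) :
  exists u C : R, 0 < u /\ 0 < C /\
  forall rho mu : R, 0 < rho -> rho < 1 -> 0 <= mu -> mu < 1 ->
  exists eps0 : R, 0 < eps0 /\
  forall (n : nat) (Omega : 'I_n -> finType) (w : forall i, Omega i -> R)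
    (f : {dffun forall i, Omega i} -> R) (alpha tau : R)
    (m : 'I_n -> nat) (X : forall i, 'I_(m i).+1 -> Omega i -> R)
    (c : mindex m -> R),
  (forall i, is_prob (w i)) ->
  (forall t, 0 <= f t <= 1) ->
  expect (prod_mass w) f = mu ->
  0 < alpha -> alpha <= 1 / 2 ->
  (forall i (a : Omega i), alpha <= w i a) ->
  0 < tau -> tau < 1 / 2 ->
  (forall i, orthonormal_basis1 (w i) (X i)) ->
  is_expansion X f c ->
  (forall i, low_inf c (ln (1 / tau) / Kprime alpha rho) i <= tau) ->
  forall eps delta : R, 0 < eps -> eps <= eps0 ->
  delta < eps `^ (rho / (1 - rho) + C * kappa rho mu eps) ->
  tau <= eps `^ (100 * Kprime alpha rho / (u * (1 - rho)) *
                 (1 / (1 - rho) ^+ 3 + C * kappa rho mu eps)) ->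
  prob (joint_mass w rho) (fun p => 1 - delta < Vop w f p) <= eps.
Proof.
(* With u = 1/4 the prefactor in the condition on tau is 400 K' / (1 - rho), which matches the
   requirement 400 K' r^4 L <= ln(1/tau) with r = 1 / (1 - rho). The value C = 10 is the slack of
   [exponent_choice]. *)
exists (1 / 4), 10; split; first by rewrite divr_gt0.
split=> // rho mu rho0 rho1 mu0 mu1.
have rho1' : 0 < 1 - rho by rewrite subr_gt0.
(* The threshold contains 10 / mu, so mean zero is treated apart: all atoms have positive mass,
   hence f vanishes identically, while delta < 1 makes the event empty. *)
have [mu_z|mu_nz] := eqVneq mu 0.
  exists 1; split=> // n Omega w f alpha tau m X c Pw f01 Ef a0 _ aw _ _ _ _ _.
  move=> eps delta e0 e1 de _.
  have Ef0 : expect (prod_mass w) f = 0 by rewrite Ef.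
  have f0 t : f t = 0.
    have p0 : 0 < prod_mass w t.
      by apply: prodr_gt0 => i _; apply: lt_le_trans (aw i (t i)).
    have := psumr_eq0P _ Ef0 => /(_ _)/wrap[].
      move=> t' _; apply: mulr_ge0; first exact: (prod_mass_prob Pw).1.
      by case/andP: (f01 t').
    by move=> /(_ t isT)/eqP; rewrite mulf_eq0 gt_eqF//= => /eqP.
  have V0 p : Vop w f p = 0.
    by rewrite /Vop /expect big1// => t _; rewrite f0 mulr0.
  have d1 : delta < 1.
    apply: (lt_le_trans de); rewrite /powR gt_eqF// -[leRHS]expR0 ler_expR.
    apply: mulr_ge0_le0; last by rewrite ln_le0.
    apply: addr_ge0.
      apply: divr_ge0; first exact: ltW.
      by rewrite subr_ge0; exact: ltW.
    apply: mulr_ge0 => //; apply: mulr_ge0; last by rewrite divr_ge0.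
    by rewrite divr_ge0// subr_ge0 ltW.
  rewrite /prob big_pred0; first exact: ltW.
  by move=> p; rewrite V0 subr_lt0 ltNge (ltW d1).
have mup : 0 < mu by rewrite lt_def mu_nz.
have [eps0 [eps00 choice]] := threshold_exists rho0 rho1 mup mu1.
exists eps0; split=> // n Omega w f alpha tau m X c Pw f01 Ef a0 a1 aw t0 _ HX fc low.
move=> eps delta e0 e1 de te.
have [theta [[th0 th_rho q3 Mq thi] [kapE Lr]]] := choice eps e0 e1.
have L0 : 0 <= - ln eps by apply: le_trans thi; rewrite invr_ge0 ltW.
have [K2 _] := Kprime_ge a0 a1 rho0 rho1.
apply: (prob_restriction_le Pw f01 _ a0 a1 aw HX fc t0 _ rho0 rho1 e0 th0 th_rho
  q3 _ thi Lr); rewrite ?Ef//.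
- by move=> i; have := low i; rewrite div1r lnV.
- apply: (le_trans (ltW de)); rewrite /powR gt_eqF// kapE ler_expR.
  by apply: eq_ler; ring.
move: te; rewrite -ler_ln ?posrE ?powR_gt0// ln_powR -lerN2 -mulrN => taule.
apply: le_trans taule; apply: ler_wpM2r => //.
set K := Kprime alpha rho in K2 *; set r := (1 - rho)^-1.
have r0 : 0 <= r by rewrite invr_ge0 ltW.
have K0 : 0 <= K by apply: le_trans K2; rewrite divr_ge0.
have -> : 100 * K / (1 / 4 * (1 - rho)) = 400 * K * r.
  by rewrite /r; field; rewrite gt_eqF.
have -> : 1 / (1 - rho) ^+ 3 = r ^+ 3 by rewrite div1r /r exprVn.
have -> : 400 * K * r ^+ 4 = 400 * K * r * r ^+ 3 by ring.
apply: ler_wpM2l; first by apply: mulr_ge0 r0; exact: mulr_ge0 (ler0n _ _) K0.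
rewrite lerDl kapE; apply: mulr_ge0; first exact: ler0n.
by rewrite divr_ge0// ltW.
Qed.
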